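(* Let $(K,\delta)$ be a differential field (arbitrary characteristic). The following are equivalent: (1) $(K,\delta)$ is separably differentially closed; (2) for every differentially algebraic extension $(L,\delta)$ of $(K,\delta)$, if $L/K$ is separable (as fields) then $(K,\delta)$ is existentially closed in $(L,\delta)$; (3) $(K,\delta)$ is constrainedly closed; (4) for each $n$ and every separable prime differential ideal $P$ of $K\{x_1,\dots,x_n\}$, if $g\in K\{x_1,\dots,x_n\}\setminus P$ then there is $\bar a\in K^n$ such that $f(\bar a)=0$ for all $f\in P$ and $g(\bar a)\neq 0$.
   Context: Existential closedness is in the language of differential fields $\{0,1,+,-,\cdot,{}^{-1},\delta\}$. $(K,\delta)$ is separably differentially closed if it is existentially closed in every differential field extension $(L,\delta)$ with $L/K$ separable. An extension is differentially algebraic if each element $a$ satisfies a nonzero differential polynomial over $K$ (i.e. $(\delta^ja)_{j\ge0}$ is algebraically dependent over $K$). $K\{x_1,\dots,x_n\}$ is the differential polynomial ring; a prime differential ideal $P$ is separable if $\operatorname{Frac}(K\{\bar x\}/P)$ is separable over $K$. For a tuple $\bar\alpha$ from a differential field extension, $I_\delta(\bar\alpha/K)=\{f\in K\{\bar x\}:f(\bar\alpha)=0\}$; a differential specialisation is a tuple $\bar\beta$ (in some differential field extension of $K$) with $I_\delta(\bar\alpha/K)\subseteq I_\delta(\bar\beta/K)$, generic if equality holds. $\bar\alpha$ is constrained over $K$ if $K\langle\bar\alpha\rangle/K$ is separable and there is $g\in K\{\bar x\}$ with $g(\bar\alpha)\ne0$ such that every differential specialisation $\bar\beta$ with $K\langle\bar\beta\rangle/K$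 separable and $g(\bar\beta)\ne0$ is generic. $(K,\delta)$ is constrainedly closed if every finite tuple (from any differential field extension) constrained over $K$ has all its entries in $K$. *)

(* Defs.v *)
From HB Require Import structures.
From mathcomp Require Import all_boot all_order all_algebra.
From mathcomp Require Import generic_quotient ring_quotient fraction finmap.
From mathcomp.multinomials Require Import monalg.
From mathcomp Require boolp.

Set Implicit Arguments.
Unset Strict Implicit.
Unset Printing Implicit Defensive.

Import GRing.Theory.

Local Open Scope ring_scope.
Local Open Scope quotient_scope.

Definition derivation (R : nzRingType) (d : R -> R) : Prop :=
  (forall x y, d (x + y) = d x + d y) /\
  (forall x y, d (x * y) = d x * y + x * d y).

Record diffField := DiffField {
  df_field :> fieldType;
  der : df_field -> df_field;
  der_derivation : derivation der }.

Arguments der {d} _.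

Record diffExt (K : diffField) := DiffExt {
  de_field :> diffField;
  de_inj : {rmorphism K -> de_field};
  de_injE : forall x : K, de_inj (der x) = der (de_inj x) }.

Arguments de_inj {K} d.

Definition diffExt_refl (K : diffField) : diffExt K :=
  @DiffExt K K idfun (fun _ => erefl).

Definition df_subfield (L : diffField) (F : L -> Prop) : Prop :=
  [/\ F 1,
      forall x y, F x -> F y -> F (x - y),
      forall x y, F x -> F y -> F (x * y),
      forall x, F x -> F x^-1
    & forall x, F x -> F (der x)].

(* The underlying set of K<a>, as a subset of L *)
Definition df_adjoin (K : diffField) (L : diffExt K) n (a : 'I_n -> L)
    (y : L) : Prop :=
  forall F : L -> Prop, df_subfield F -> (forall c : K, F (de_inj L c)) ->
    (forall i, F (a i)) -> F y.

Section Separable.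
Variable L : fieldType.
Implicit Types A B C : L -> Prop.

Definition lin_indep C m (b : 'I_m -> L) : Prop :=
  forall c : 'I_m -> L, (forall i, C (c i)) ->
    \sum_i c i * b i = 0 -> forall i, c i = 0.

Definition lin_disjoint A B C : Prop :=
  forall m (b : 'I_m -> L), (forall i, A (b i)) ->
    lin_indep C b -> lin_indep B b.

Definition powers p A (y : L) : Prop := exists2 x, A x & y = x ^+ p.

End Separable.

(* Mac Lane's condition: an extension F/K in characteristic p > 0 is separable
   iff K and F^p are linearly disjoint over K^p; no condition in
   characteristic 0, where [pchar K] is empty.  F is an intermediate field of
   iota : K -> L, given by its underlying set. *)
Definition separable_in (K L : fieldType) (iota : {rmorphism K -> L})
    (F : L -> Prop) : Prop :=
  let K' (y : L) := exists c : K, y = iota c in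
  forall p, p \in [pchar K] -> lin_disjoint K' (powers p F) (powers p K').

Definition separable_ext (K L : fieldType) (iota : {rmorphism K -> L}) : Prop :=
  separable_in iota (fun _ => True).

(* Terms with parameters in K; as usual 0^-1 = 0, which is also the value of
   the library's inverse at 0. *)
Inductive dterm (K : Type) (n : nat) : Type :=
| TVar of 'I_n
| TPar of K
| TZero
| TOne
| TAdd of dterm K n & dterm K n
| TOpp of dterm K n
| TMul of dterm K n & dterm K n
| TInv of dterm K n
| TDer of dterm K n.

Inductive dqf (K : Type) (n : nat) : Type :=
| FEq of dterm K n & dterm K n
| FNot of dqf K n
| FAnd of dqf K n & dqf K n
| FOr of dqf K n & dqf K n.

Section Semantics.
Variables (K : diffField) (L : diffExt K) (n : nat) (a : 'I_n -> L).

Fixpoint dterm_eval (t : dterm K n) : L :=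
  match t with
  | TVar i => a i
  | TPar c => de_inj L c
  | TZero => 0
  | TOne => 1
  | TAdd t1 t2 => dterm_eval t1 + dterm_eval t2
  | TOpp t1 => - dterm_eval t1
  | TMul t1 t2 => dterm_eval t1 * dterm_eval t2
  | TInv t1 => (dterm_eval t1)^-1
  | TDer t1 => der (dterm_eval t1)
  end.

Fixpoint dqf_holds (phi : dqf K n) : Prop :=
  match phi with
  | FEq t1 t2 => dterm_eval t1 = dterm_eval t2
  | FNot phi1 => ~ dqf_holds phi1
  | FAnd phi1 phi2 => dqf_holds phi1 /\ dqf_holds phi2
  | FOr phi1 phi2 => dqf_holds phi1 \/ dqf_holds phi2
  end.

End Semantics.

Definition existentially_closed (K : diffField) (L : diffExt K) : Prop :=
  forall n (phi : dqf K n),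
    (exists a : 'I_n -> L, dqf_holds a phi) ->
    exists b : 'I_n -> diffExt_refl K, dqf_holds b phi.

(* K{x_1, ..., x_n}: the polynomial ring over K in the indeterminates
   (i, j) : 'I_n * nat, where (i, j) stands for delta^j x_i. *)
Notation dpoly K n := {malg K[{cmonom ('I_n * nat)%type}]}.

Section DPoly.
Variables (K : diffField) (n : nat).
Local Notation I := ('I_n * nat)%type.
Local Notation mon := {cmonom I}.
Implicit Types (m : mon) (v : I) (f g : dpoly K n).

Definition dpolyC (c : K) : dpoly K n := c%:MP.

HB.instance Definition _ :=
  GRing.RMorphism.copy dpolyC (@mkmalgU mon K mone).

Definition dpolyX (i : 'I_n) (j : nat) : dpoly K n := << ucm (i, j) >>.

(* delta (prod_v v^(m v)) = sum_v m(v) * v^(m(v) - 1) * delta v * (rest),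
   with delta (i, j) = (i, j + 1) *)
Definition mon_der m : dpoly K n :=
  \sum_(v <- finsupp m)
     << (m v)%:R *g mmul (divcm m (ucm v)) (ucm (v.1, v.2.+1)) >>.

Definition dpoly_der f : dpoly K n :=
  \sum_(m <- msupp f) (<< der f@_m *g m >> + f@_m *: mon_der m).

Definition mon_eval (L : diffExt K) (a : 'I_n -> L) m : L :=
  \prod_(v <- finsupp m) iter v.2 der (a v.1) ^+ m v.

Definition dpoly_eval (L : diffExt K) (a : 'I_n -> L) f : L :=
  mmap (de_inj L) (mon_eval a) f.

Lemma mon_derEw (d : {fset I}) m : (finsupp m `<=` d)%fset ->
  mon_der m =
  \sum_(v <- d) << (m v)%:R *g mmul (divcm m (ucm v)) (ucm (v.1, v.2.+1)) >>.
Proof.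
move=> le; rewrite /mon_der (big_fset_incl _ le) // => v _ vNm.
by move: vNm; rewrite -cmE_eq0 => /eqP->; rewrite monalgU0.
Qed.

Lemma malgMUU (c1 c2 : K) m1 m2 :
  << c1 *g m1 >> * << c2 *g m2 >> = << c1 * c2 *g mmul m1 m2 >> :> dpoly K n.
Proof. exact: fgmulUU. Qed.

Lemma divcmM m1 m2 v : (0 < m1 v)%N ->
  divcm (mmul m1 m2) (ucm v) = mmul (divcm m1 (ucm v)) m2.
Proof.
move=> m1v; apply/eqP/cmP => w; rewrite cmM !divcmE cmM ucmE.
by case: eqVneq => [<-|_]; rewrite ?subn0 // addnBAC.
Qed.

Lemma mon_derM m1 m2 :
  mon_der (mmul m1 m2) = mon_der m1 * << m2 >> + << m1 >> * mon_der m2.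
Proof.
rewrite (@mon_derEw (finsupp m1 `|` finsupp m2)%fset); last by rewrite mdomD.
rewrite (@mon_derEw (finsupp m1 `|` finsupp m2)%fset m1) ?fsubsetUl //.
rewrite (@mon_derEw (finsupp m1 `|` finsupp m2)%fset m2) ?fsubsetUr //.
rewrite [X in X + _]mulr_suml [X in _ + X]mulr_sumr -big_split.
apply: eq_bigr => v _ /=.
rewrite [in X in _ = X + _]malgMUU [in X in _ = _ + X]malgMUU.
rewrite mulr1 mul1r cmM natrD.
rewrite monalgUD.
apply: (f_equal2 +%R).
  case: (posnP (m1 v)) => [->|m1v]; first by rewrite !monalgU0.
  by rewrite (divcmM _ m1v) -!mulmA (mulmC m2).
case: (posnP (m2 v)) => [->|m2v]; first by rewrite !monalgU0.
by rewrite (mulmC m1 m2) (divcmM _ m2v) (mulmC _ m1) -mulmA.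
Qed.

Lemma der0 (F : diffField) : der (0 : F) = 0.
Proof.
by have [dD _] := @der_derivation F; apply: (addIr (der 0)); rewrite -dD !add0r.
Qed.

Lemma der1 (F : diffField) : der (1 : F) = 0.
Proof.
have [_ dM] := @der_derivation F; apply: (addIr (der 1)); rewrite add0r.
by rewrite -[in RHS](mulr1 1) dM mulr1 mul1r.
Qed.

Lemma dpoly_derEw (d : {fset mon}) f : (msupp f `<=` d)%fset ->
  dpoly_der f = \sum_(m <- d) (<< der f@_m *g m >> + f@_m *: mon_der m).
Proof.
move=> le; rewrite /dpoly_der (big_fset_incl _ le) // => m _ mNf.
by rewrite mcoeff_outdom // der0 monalgU0 scale0r addr0.
Qed.

Lemma dpoly_derD f g : dpoly_der (f + g) = dpoly_der f + dpoly_der g.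
Proof.
have [dD _] := @der_derivation K.
rewrite (dpoly_derEw (msuppD_le f g)).
rewrite (dpoly_derEw (fsubsetUl (msupp f) (msupp g))).
rewrite (dpoly_derEw (fsubsetUr (msupp f) (msupp g))) -big_split /=.
by apply: eq_bigr => m _; rewrite mcoeffD dD monalgUD scalerDl addrACA.
Qed.

Lemma dpoly_derU c m :
  dpoly_der << c *g m >> = << der c *g m >> + c *: mon_der m.
Proof.
by rewrite (dpoly_derEw msuppU_le) big_seq_fset1 mcoeffUU.
Qed.

Lemma dpoly_derUM c1 m1 c2 m2 :
  dpoly_der (<< c1 *g m1 >> * << c2 *g m2 >>) =
  dpoly_der << c1 *g m1 >> * << c2 *g m2 >>
  + << c1 *g m1 >> * dpoly_der << c2 *g m2 >>.
Proof.
have [_ dM] := @der_derivation K.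
have UZ (c : K) m : << c *g m >> = c *: << m >> :> dpoly K n.
  by rewrite -[RHS]mul_malgC malgMUU mulr1 mul1m.
(* Unification diverges on concrete monomials, hence the abstraction. *)
have gen (R : comAlgType K) (U : K -> mon -> R) (D : R -> R) (E : mon -> R) :
    (forall m, {morph U^~ m : x y / x + y}) ->
    (forall c m, U c m = c *: U 1 m) ->
    (forall c d m m', U c m * U d m' = U (c * d) (mmul m m')) ->
    (forall c m, D (U c m) = U (der c) m + c *: E m) ->
    (forall m m', E (mmul m m') = E m * U 1 m' + U 1 m * E m') ->
  D (U c1 m1 * U c2 m2) = D (U c1 m1) * U c2 m2 + U c1 m1 * D (U c2 m2).
  move=> UD {}UZ UM DU EM; rewrite UM !DU EM dM UD -!UM mulrDl mulrDr.
  rewrite !(UZ c1) !(UZ c2) -!scalerAl -!scalerAr !scalerA scalerDr.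
  by rewrite addrACA.
apply: (gen (dpoly K n) (fun c m => << c *g m >>) dpoly_der mon_der) => //.
- by move=> m x y; exact: monalgUD.
- exact: malgMUU.
- exact: dpoly_derU.
- exact: mon_derM.
Qed.

Lemma dpoly_derM f g : dpoly_der (f * g) = dpoly_der f * g + f * dpoly_der g.
Proof.
have gen (R : comNzRingType) (D : R -> R) (r s : seq mon) (F G : mon -> R) :
    {morph D : x y / x + y} ->
    (forall i j, D (F i * G j) = D (F i) * G j + F i * D (G j)) ->
  let f := \sum_(i <- r) F i in let g := \sum_(j <- s) G j in
  D (f * g) = D f * g + f * D g.
  move=> DD DM; have D0 : D 0 = 0.
    by apply: (addIr (D 0)); rewrite -DD !add0r.
  have Dsum (q : seq mon) H : D (\sum_(i <- q) H i) = \sum_(i <- q) D (H i).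
    exact: (big_morph D DD D0).
  rewrite /= mulr_suml !Dsum !mulr_suml -big_split; apply: eq_bigr => i _ /=.
  by rewrite !mulr_sumr Dsum -big_split; apply: eq_bigr => j _; rewrite DM.
rewrite [f in LHS]monalgE [g in LHS]monalgE (gen _ _ _ _ _ _ dpoly_derD).
  by rewrite -!monalgE.
by move=> m m'; exact: dpoly_derUM.
Qed.

Lemma dpoly_der_derivation : derivation dpoly_der.
Proof. by split; [exact: dpoly_derD | exact: dpoly_derM]. Qed.

Lemma dpoly_derC c : dpoly_der (dpolyC c) = dpolyC (der c).
Proof. by rewrite dpoly_derU /mon_der mdom1 big_seq_fset0 scaler0 addr0. Qed.

Lemma dpoly_derX i j : dpoly_der (dpolyX i j) = dpolyX i j.+1.
Proof.
rewrite dpoly_derU /mon_der mdomU big_seq_fset1 der1 monalgU0 add0r scale1r cmUU.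
suff -> : divcm (ucm (i, j)) (ucm (i, j)) = mone by rewrite mul1m.
by apply/eqP/cmP => w; rewrite divcmE subnn cm1.
Qed.

Lemma mon_eval_mmorphism (L : diffExt K) (a : 'I_n -> L) :
  mmorphism (mon_eval a).
Proof.
have Ew (d : {fset I}) m : (finsupp m `<=` d)%fset ->
    mon_eval a m = \prod_(v <- d) iter v.2 der (a v.1) ^+ m v.
  move=> le; rewrite /mon_eval (big_fset_incl _ le) // => v _.
  by rewrite -cmE_eq0 => /eqP->.
split=> [m1 m2|]; last by rewrite /mon_eval mdom1 big_seq_fset0.
rewrite (Ew (finsupp m1 `|` finsupp m2)%fset); last by rewrite mdomD.
rewrite (Ew (finsupp m1 `|` finsupp m2)%fset m1) ?fsubsetUl //.
rewrite (Ew (finsupp m1 `|` finsupp m2)%fset m2) ?fsubsetUr //.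
by rewrite -big_split; apply: eq_bigr => v _; rewrite cmM exprD.
Qed.

HB.instance Definition _ (L : diffExt K) (a : 'I_n -> L) :=
  isMultiplicative.Build mon L (mon_eval a) (mon_eval_mmorphism a).

HB.instance Definition _ (L : diffExt K) (a : 'I_n -> L) :=
  GRing.RMorphism.copy (dpoly_eval a) (mmap (de_inj L) (mon_eval a)).

Lemma dpoly_evalC (L : diffExt K) (a : 'I_n -> L) c :
  dpoly_eval a (dpolyC c) = de_inj L c.
Proof. exact: mmapC. Qed.

Lemma dpoly_evalX (L : diffExt K) (a : 'I_n -> L) i j :
  dpoly_eval a (dpolyX i j) = iter j der (a i).
Proof.
by rewrite /dpoly_eval mmapU /= rmorph1 mul1r /mon_eval mdomU big_seq_fset1 cmUU.
Qed.

Lemma dpoly_eval_der (L : diffExt K) (a : 'I_n -> L) f :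
  dpoly_eval a (dpoly_der f) = der (dpoly_eval a f).
Proof.
have [dD dM] := @der_derivation L.
have evU c m : dpoly_eval a << c *g m >> = de_inj L c * mon_eval a m.
  exact: mmapU.
have evX v : mon_eval a (ucm v) = iter v.2 der (a v.1).
  by case: v => i j; rewrite -[RHS]dpoly_evalX evU rmorph1 mul1r.
have monM m m' : mon_eval a (mmul m m') = mon_eval a m * mon_eval a m'.
  exact: (mon_eval_mmorphism a).1.
have mon1 : mon_eval a mone = 1 by exact: (mon_eval_mmorphism a).2.
have evD x y : dpoly_eval a (x + y) = dpoly_eval a x + dpoly_eval a y.
  exact: rmorphD.
have evM x y : dpoly_eval a (x * y) = dpoly_eval a x * dpoly_eval a y.
  exact: rmorphM.
have evDM x y z t : dpoly_eval a (x * y + z * t) =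
    dpoly_eval a x * dpoly_eval a y + dpoly_eval a z * dpoly_eval a t.
  exact: etrans (evD _ _) (f_equal2 +%R (evM _ _) (evM _ _)).
have ev_mon m : dpoly_eval a (mon_der m) = der (mon_eval a m).
  have [k] := ubnP (mdeg m); elim: k m => // k IHk m.
  have [->|m1] := eqVneq m mone.
    by rewrite /mon_der mdom1 big_seq_fset0 mon1 der1 rmorph0.
  have [v mv] : exists v, (0 < m v)%N.
    have /fset0Pn [v] : finsupp m != fset0.
      apply: contraNneq m1 => m0; apply/cmP => v.
      by rewrite cm1; apply/eqP; rewrite cmE_eq0 m0.
    by rewrite -cmE_neq0 -lt0n; exists v.
  have -> : m = mmul (ucm v) (divcm m (ucm v)).
    apply/eqP/cmP => w; rewrite cmM divcmE ucmE.
    by case: eqVneq => [<-|_] /=; rewrite ?add0n ?subn0 // subnKC.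
  move: (divcm m (ucm v)) => m'; rewrite mdegM mdegU add1n ltnS => m'k.
  have {}IHk := IHk _ m'k.
  have evdX : dpoly_eval a (mon_der (ucm v)) = der (mon_eval a (ucm v)).
    rewrite evX; case: v {mv m1 IHk m'k} => i j /=.
    have := dpoly_derX i j; rewrite dpoly_derU der1 monalgU0 add0r scale1r => ->.
    exact: dpoly_evalX.
  refine (etrans (congr1 (dpoly_eval a) (mon_derM _ _)) (etrans (evDM _ _ _ _) _)).
  refine (etrans (f_equal2 +%R (f_equal2 *%R evdX (evU 1 m'))
                               (f_equal2 *%R (evU 1 (ucm v)) IHk)) _).
  by rewrite rmorph1 !mul1r monM dM.
rewrite (monalgE f) (big_morph _ dpoly_derD (id1 := 0)); last first.
  by rewrite /dpoly_der msupp0 big_seq_fset0.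
rewrite !rmorph_sum (big_morph _ dD (der0 L)); apply: eq_bigr => m _ /=.
refine (etrans (congr1 (dpoly_eval a) (dpoly_derU _ _)) (etrans (evD _ _) _)).
refine (etrans _ (congr1 der (esym (evU _ _)))); rewrite dM -de_injE.
by apply: (f_equal2 +%R (evU _ _)); rewrite -mul_malgC evM ev_mon dpoly_evalC.
Qed.

End DPoly.

Definition diff_algebraic (K : diffField) (L : diffExt K) : Prop :=
  forall a : L, exists2 f : dpoly K 1, f != 0 & dpoly_eval (fun=> a) f = 0.

Section PrimeQuotient.
Variables (R : comNzRingType) (P : prime_idealr R).

(* R/P; the library makes it a commutative ring only, here it becomes an
   integral domain with (classically chosen) inverses of units. *)
Definition pquot : Type := {ideal_quot P}.
HB.instance Definition _ := GRing.ComNzRing.on pquot.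

Definition pquot_unit : pred pquot :=
  fun x => boolp.asbool (exists y : pquot, y * x = 1).

Definition pquot_inv (x : pquot) : pquot :=
  if boolp.pselect (exists y : pquot, y * x = 1) is left h
  then sval (boolp.cid h) else x.

Fact pquot_mulVr : {in pquot_unit, left_inverse 1 pquot_inv *%R}.
Proof.
move=> x; rewrite unfold_in => /boolp.asboolP ux.
rewrite /pquot_inv; case: boolp.pselect => // h.
by case: boolp.cid.
Qed.

Fact pquot_unitPl (x y : pquot) : y * x = 1 -> pquot_unit x.
Proof. by move=> yx1; apply/boolp.asboolP; exists y. Qed.

Fact pquot_inv_out : {in [predC pquot_unit], pquot_inv =1 id}.
Proof.
move=> x; rewrite inE unfold_in => /boolp.asboolPn nux.
by rewrite /pquot_inv; case: boolp.pselect.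
Qed.

HB.instance Definition _ := GRing.ComNzRing_hasMulInverse.Build pquot
  pquot_mulVr pquot_unitPl pquot_inv_out.

HB.instance Definition _ := GRing.ComUnitRing_isIntegral.Build pquot
  (@Quotient.rquot_IdomainAxiom R P).

Definition pquot_frac : fieldType := {fraction pquot}.

Definition pquot_frac_pi (f : R) : pquot_frac :=
  tofrac (\pi_({ideal_quot P}) f : pquot).

Fact pquot_frac_pi_zmod : zmod_morphism pquot_frac_pi.
Proof. by move=> x y; rewrite /pquot_frac_pi !rmorphB. Qed.

Fact pquot_frac_pi_monoid : monoid_morphism pquot_frac_pi.
Proof.
by split=> [|x y]; rewrite /pquot_frac_pi ?rmorph1 ?rmorphM.
Qed.

HB.instance Definition _ :=
  GRing.isZmodMorphism.Build R pquot_frac pquot_frac_pi pquot_frac_pi_zmod.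
HB.instance Definition _ :=
  GRing.isMonoidMorphism.Build R pquot_frac pquot_frac_pi pquot_frac_pi_monoid.

End PrimeQuotient.

Definition diff_ideal (K : diffField) n (P : {pred dpoly K n}) : Prop :=
  forall f, f \in P -> dpoly_der f \in P.

Definition separable_ideal (K : diffField) n (P : prime_idealr (dpoly K n)) :
    Prop :=
  separable_ext (@pquot_frac_pi _ P \o @dpolyC K n : {rmorphism K -> _}).

Section Constrained.
Variables (K : diffField) (n : nat).

Definition diff_specialisation (L M : diffExt K) (a : 'I_n -> L)
    (b : 'I_n -> M) : Prop :=
  forall f : dpoly K n, dpoly_eval a f = 0 -> dpoly_eval b f = 0.

Definition generic_specialisation (L M : diffExt K) (a : 'I_n -> L)
    (b : 'I_n -> M) : Prop :=
  forall f : dpoly K n, dpoly_eval a f = 0 <-> dpoly_eval b f = 0.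

Definition constrained (L : diffExt K) (a : 'I_n -> L) : Prop :=
  separable_in (de_inj L) (df_adjoin a) /\
  exists2 g : dpoly K n, dpoly_eval a g != 0 &
    forall (M : diffExt K) (b : 'I_n -> M),
      diff_specialisation a b ->
      separable_in (de_inj M) (df_adjoin b) ->
      dpoly_eval b g != 0 ->
      generic_specialisation a b.

End Constrained.

Definition constrainedly_closed (K : diffField) : Prop :=
  forall n (L : diffExt K) (a : 'I_n -> L), constrained a ->
    forall i, exists c : K, a i = de_inj L c.

Definition separably_diff_closed (K : diffField) : Prop :=
  forall L : diffExt K, separable_ext (de_inj L) -> existentially_closed L.

(* Main.v *)
(** A generic zero of a separable prime differential ideal P generates
    L = K<a>.  List the derivatives of a in order as e_0, e_1, ... ([gen_pt]), with
    delta e_r = e_(r+n), and let E_r = K(e_s : s < r) ([stage]).  Call r a leader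
    ([sep_stage]) if e_r is separably algebraic over E_r; then e_(r+n) lies in
    E_(r+n), so leaders are closed under adding n.  If no index congruent to r
    modulo n is a leader, r is free ([free_index]).
    Free e_r are algebraically independent over K: in characteristic p, a
    dependence would by Mac Lane's criterion give some free l with e_l in
    A_l = K(e_s (s < l), all e_s^p (s <= r0)); since p-th powers are constants,
    applying delta repeatedly yields e_(l+kn) in A_(l+kn), which is E_(l+kn)
    for large k, so l + kn would be a leader.  By exchange, e_r is therefore
    transcendental over E_r for every large free r.

    Hence, for large N, E_N becomes a differential field by setting the free
    e_r with r >= N to 0.  It is differentially algebraic and separable over K,
    and a K-point of the finitely many relations among e_0, ..., e_(N-1), off
    the separants of the leaders, is a zero of all of P.  So (2) implies (4).
    Conversely (4) gives (1) and (3) by taking P to be a vanishing ideal, and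
    (3) gives (4) because the generic zero of a maximal separable prime
    differential ideal avoiding g is constrained by g. *)

Require Import Defs.
From HB Require Import structures.
From mathcomp Require Import all_boot all_order all_algebra polyXY ring_quotient.
From mathcomp Require Import generic_quotient fraction finmap.
From mathcomp.multinomials Require Import monalg.
From mathcomp Require Import boolp zify ring.
From mathcomp Require classical_sets.

Set Implicit Arguments.
Unset Strict Implicit.
Unset Printing Implicit Defensive.

Import GRing.Theory.
Local Open Scope ring_scope.

(** * Generated subfields and algebraic elements *)

Section GeneratedSubfield.
Variable L : fieldType.
Implicit Types (S Q : L -> Prop) (E F : divringClosed L).

(** Intersecting all closed predicates makes the result itself a [divringClosed] predicate, so the
    [rpred] lemmas apply to every field defined from it. *)
Definition sgen S : {pred L} :=
  fun x => `[< forall F : divringClosed L, (forall y, S y -> y \in F) -> x \in F >].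

Fact sgen_closed S : divring_closed (sgen S).
Proof.
split=> [|x y /asboolP hx /asboolP hy|x y /asboolP hx /asboolP hy]; apply/asboolP => F hF.
- exact: rpred1.
- by rewrite rpredB ?hx ?hy.
- by rewrite rpred_div ?hx ?hy.
Qed.

HB.instance Definition _ S := GRing.isDivringClosed.Build L (sgen S) (sgen_closed S).

Lemma sgen_mem S y : S y -> y \in sgen S.
Proof. by move=> Sy; apply/asboolP => F; apply. Qed.

Lemma sgen_min S F : (forall y, S y -> y \in F) -> {subset sgen S <= F}.
Proof. by move=> hF x /asboolP; apply. Qed.

Definition propset Q : {pred L} := fun x => `[< Q x >].

Section PropClosed.
Variables (Q : L -> Prop) (Q1 : Q 1) (QB : forall x y, Q x -> Q y -> Q (x - y)).
Variable QV : forall x y, Q x -> Q y -> Q (x / y).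
Fact propset_closed : divring_closed (propset Q).
Proof.
by split=> [|x y /asboolP hx /asboolP hy|x y /asboolP hx /asboolP hy];
  apply/asboolP; auto.
Qed.
Definition mk_subfield : divringClosed L :=
  HB.pack (propset Q) (GRing.isDivringClosed.Build L (propset Q) propset_closed).

Lemma mk_subfieldE x : x \in mk_subfield <-> Q x.
Proof. by split=> /asboolP. Qed.
End PropClosed.

Lemma sgen_ind S Q : Q 1 -> (forall x y, Q x -> Q y -> Q (x - y)) ->
  (forall x y, Q x -> Q y -> Q (x / y)) -> (forall y, S y -> Q y) ->
  forall x, x \in sgen S -> Q x.
Proof.
move=> Q1 QB QV SQ x /(@sgen_min _ (mk_subfield Q1 QB QV)) h.
by apply/(mk_subfieldE Q1 QB QV)/h => y /SQ ?; apply/mk_subfieldE.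
Qed.

Lemma sgenS S S' : (forall x, S x -> x \in sgen S') -> {subset sgen S <= sgen S'}.
Proof. exact: sgen_min. Qed.

Definition adjoin E z := sgen (fun y => y \in E \/ y = z).

Lemma adjoin_sub E z : {subset E <= adjoin E z}.
Proof. by move=> x Ex; apply: sgen_mem; left. Qed.

Lemma adjoin_gen E z : z \in adjoin E z.
Proof. by apply: sgen_mem; right. Qed.

Lemma adjoinP E z x : x \in adjoin E z ->
  exists p q : {poly L}, [/\ p \is a polyOver E, q \is a polyOver E, q.[z] != 0
    & x = p.[z] / q.[z]].
Proof.
move: x; apply: sgen_ind.
- by exists 1, 1; rewrite !rpred1 hornerE oner_eq0 divr1.
- move=> _ _ [p1 [q1 [Ep1 Eq1 n1 ->]]] [p2 [q2 [Ep2 Eq2 n2 ->]]].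
  exists (p1 * q2 - p2 * q1), (q1 * q2); rewrite rpredB ?rpredM // !hornerE mulf_neq0 //.
  split=> //; rewrite -mulNr addf_div //; congr (_ / _).
  by rewrite mulNr.
- move=> _ _ [p1 [q1 [Ep1 Eq1 n1 ->]]] [p2 [q2 [Ep2 Eq2 n2 ->]]].
  have [p20|p20] := eqVneq p2.[z] 0.
    by exists 0, 1; rewrite p20 mul0r invr0 mulr0 !hornerE ?mul0r rpred0 rpred1 oner_eq0.
  exists (p1 * q2), (q1 * p2); rewrite !rpredM // !hornerE mulf_neq0 //.
  by split=> //; rewrite invf_div mulf_div.
- move=> y [Ey|->].
    by exists y%:P, 1; rewrite polyOverC rpred1 !hornerE oner_eq0 divr1.
  by exists 'X, 1; rewrite polyOverX rpred1 !hornerE oner_eq0 divr1.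
Qed.

(** Multiplying the denominators one at a time gives a common one. This turns relations over E(z)
    into polynomial relations in z over E. *)
Lemma adjoinD E z m (c : 'I_m -> L) : (forall i, c i \in adjoin E z) ->
  exists2 q : {poly L}, q \is a polyOver E /\ q.[z] != 0 &
  exists2 p : 'I_m -> {poly L}, forall i, p i \is a polyOver E &
    forall i, q.[z] * c i = (p i).[z].
Proof.
elim: m c => [|m IHm] c hc.
  by exists 1; rewrite ?rpred1 ?hornerE ?oner_eq0 //; exists (fun=> 0); case.
have [q [Eq nq] [p Ep pE]] := IHm (fun i => c (lift ord0 i)) (fun i => hc _).
have [p1 [q1 [Ep1 Eq1 n1 cE]]] := adjoinP (hc ord0).
exists (q * q1); first by rewrite rpredM // hornerM mulf_neq0.
exists (fun i => if unlift ord0 i is Some j then q1 * p j else q * p1).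
  by move=> i; case: unliftP => [j|] _; rewrite rpredM.
move=> i; case: unliftP => [j ->|->].
  by rewrite !hornerM mulrAC pE mulrC.
by rewrite !hornerM cE -mulrA; congr (_ * _); rewrite mulrC divfK.
Qed.

Definition algebraic_over E x :=
  exists2 p : {poly L}, p \is a polyOver E & p != 0 /\ p.[x] = 0.

(** A simple root of some p over E has a separable minimal polynomial m: if p = m r, then p'(x) =
    m'(x) r(x). So no minimal polynomial has to be carried along. *)
Definition sepalgebraic_over E x :=
  exists2 p : {poly L}, p \is a polyOver E & p.[x] = 0 /\ p^`().[x] != 0.

Lemma algebraic_overS E F x : {subset E <= F} ->
  algebraic_over E x -> algebraic_over F x.
Proof. by move=> EF [p Ep h]; exists p => //; apply: polyOverS Ep. Qed.

Lemma mem_sepalgebraic E x : x \in E -> sepalgebraic_over E x.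
Proof.
by move=> Ex; exists ('X - x%:P); rewrite ?polyOverXsubC // derivXsubC !hornerE subrr oner_eq0.
Qed.

Lemma sepalgebraic_algebraic E x : sepalgebraic_over E x -> algebraic_over E x.
Proof.
case=> p Ep [px p'x]; exists p => //; split=> //.
by apply: contra_neq p'x => ->; rewrite deriv0 horner0.
Qed.

Lemma mem_algebraic E x : x \in E -> algebraic_over E x.
Proof. by move/mem_sepalgebraic/sepalgebraic_algebraic. Qed.

Lemma algebraic_minpoly E x : algebraic_over E x ->
  exists2 p : {poly L}, p \is a polyOver E & [/\ p != 0, p.[x] = 0 &
    forall q : {poly L}, q \is a polyOver E -> (size q < size p)%N -> q.[x] = 0 -> q = 0].
Proof.
move=> [p0 Ep0 [p0n p0x]].
pose T k := `[< exists2 p : {poly L}, p \is a polyOver E & [/\ p != 0, p.[x] = 0 & size p = k] >].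
have exT : exists k, T k by exists (size p0); apply/asboolP; exists p0.
case: (ex_minnP exT) => k /asboolP [p Ep [pn px sp]] kmin.
exists p => //; split=> // q Eq sq qx; apply/eqP/negPn/negP => qn.
have /kmin : T (size q) by apply/asboolP; exists q.
by rewrite leqNgt -sp sq.
Qed.

(** The derivative of the minimal polynomial has smaller degree, so it would be zero if it vanished
    at x; in characteristic 0 its top coefficient is not zero. *)
Lemma algebraic_sep0 E x : [pchar L] =i pred0 -> algebraic_over E x -> sepalgebraic_over E x.
Proof.
move=> /pcharf0P c0 /algebraic_minpoly [p Ep [pn px pmin]]; exists p => //; split=> //.
have p1 : (1 < size p)%N.
  rewrite ltnNge; apply/negP => /size1_polyC pC.
  by move: px pn; rewrite pC hornerC => ->; rewrite eqxx.
apply/eqP => /pmin; rewrite polyOver_deriv // lt_size_deriv // => /(_ isT isT).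
move/(congr1 (fun q : {poly L} => q`_(size p).-2)); rewrite coef_deriv coef0.
move: p1; case sp: (size p) => [|[|k]] //= _.
move/eqP; rewrite -mulr_natr mulf_eq0 c0 orbF => /eqP pk.
by move: pn; rewrite -lead_coef_eq0 lead_coefE sp pk eqxx.
Qed.
End GeneratedSubfield.

Section SubfieldType.
Variables (L : fieldType) (E : divringClosed L).
(** E as a field in its own right, so that polynomial division and integrality apply to polynomials
    over E. It also carries the truncated derivation of [stage_diffExt]. *)
Definition subfield_type := {x : L | x \in E}.
HB.instance Definition _ := SubType.on subfield_type.
HB.instance Definition _ := Choice.on subfield_type.
HB.instance Definition _ := [SubChoice_isSubIntegralDomain of subfield_type by <:].
HB.instance Definition _ := [SubIntegralDomain_isSubField of subfield_type by <:].
End SubfieldType.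

Section Algebraic.
Variable L : fieldType.
Implicit Types (E F : divringClosed L).

Lemma polyOver_lift E (p : {poly L}) : p \is a polyOver E ->
  exists q : {poly subfield_type E}, p = map_poly val q.
Proof.
move=> /polyOverP Ep; exists (\poly_(i < size p) Sub p`_i (Ep i)).
apply/polyP => i; rewrite coef_map coef_poly.
by case: ltnP => [_|le] /=; rewrite ?SubK // nth_default.
Qed.

Lemma polyOver_val E (q : {poly subfield_type E}) : map_poly val q \is a polyOver E.
Proof. by apply/polyOverP => i; rewrite coef_map; apply: valP. Qed.

Lemma polyOver_modp E (p q : {poly L}) : p \is a polyOver E -> q \is a polyOver E ->
  p %% q \is a polyOver E.
Proof.
move=> /polyOver_lift [p' ->] /polyOver_lift [q' ->].
by rewrite -map_modp polyOver_val.
Qed.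

Lemma algebraic_overE E x :
  algebraic_over E x <-> algebraicOver (val : subfield_type E -> L) x.
Proof.
split=> [[p /polyOver_lift [q ->] [qn qx]]|[q qn qx]].
  by exists q; rewrite ?(map_poly_eq0 val) // in qn *; apply/eqP.
exists (map_poly val q); first exact: polyOver_val.
by split; [rewrite map_poly_eq0 | apply/eqP].
Qed.

Lemma algebraic_trans E F b : (forall y, y \in F -> algebraic_over E y) ->
  algebraic_over F b -> algebraic_over E b.
Proof.
move=> algF [p /polyOverP Fp [pn pb]].
apply/algebraic_overE/integral_algebraic/(integral_root pn); first exact/eqP.
apply/integral_poly => i; apply/integral_algebraic/algebraic_overE/algF/Fp.
Qed.

Lemma algebraic_adjoin E z y :
  algebraic_over E z -> y \in adjoin E z -> algebraic_over E y.
Proof.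
move=> algz; move: y; apply: sgen_ind.
- exact/mem_algebraic/rpred1.
- by move=> x y /algebraic_overE ? /algebraic_overE ?; apply/algebraic_overE/algebraic_sub.
- by move=> x y /algebraic_overE ? /algebraic_overE ?; apply/algebraic_overE/algebraic_div.
- by move=> y [/mem_algebraic|->].
Qed.

Lemma algebraic_exchange E z b : algebraic_over (adjoin E z) b ->
  ~ algebraic_over E b -> algebraic_over (adjoin E b) z.
Proof.
move=> [p /polyOverP Ep [pn pb]] nalg.
have [q [Eq qz] [c Ec cE]] := @adjoinD _ E z (size p) (fun i => p`_i) (fun i => Ep i).
(* [P] lifts q(z) times p: the inner variable stands for z, the outer one for b. *)
pose P : {poly {poly L}} := \poly_(i < size p) (oapp c 0 (insub i : option 'I_(size p))).
have PE i : (P`_i) \is a polyOver E.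
  by rewrite coef_poly; case: ifP => // _; case: (insub i : option 'I_(size p)) => [j|] /=; rewrite ?rpred0.
have Pz i : (P`_i).[z] = q.[z] * p`_i.
  rewrite coef_poly; case: ltnP => [lti|le]; last by rewrite horner0 nth_default // mulr0.
  by rewrite insubT /= -cE.
have P0 : (map_poly (horner^~ z) P).[b] = 0.
  suff -> : map_poly (horner^~ z) P = q.[z] *: p by rewrite hornerZ pb mulr0.
  by apply/polyP => i; rewrite coef_map_id0 ?horner0 // coefZ Pz.
pose Q := map_poly (horner^~ b) (swapXY P).
have Qi j : Q`_j = (map_poly (fun r : {poly L} => r`_j) P).[b].
  rewrite coef_map_id0 ?horner0 //; congr (_.[_]).
  by apply/polyP => i; rewrite coef_swapXY coef_map_id0 ?coef0.
exists Q.
  apply/polyOverP => j; rewrite Qi rpred_horner ?adjoin_gen //.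
  apply/polyOverP => i; rewrite coef_map_id0 ?coef0 //.
  by apply: adjoin_sub; move/polyOverP: (PE i); apply.
split; last first.
  by rewrite -[RHS]P0 /Q -!horner_swapXY swapXYK horner2_swapXY.
(* If [Q] were zero, the coefficient in [P] of each power of z would vanish at b; one of these is a
   nonzero polynomial over E, against the transcendence of b. *)
apply/eqP => Q0; apply: nalg.
have [i pi] : exists i, p`_i != 0 by exists (size p).-1; rewrite -lead_coefE lead_coef_eq0.
have [j Pij] : exists j, (P`_i)`_j != 0.
  exists (size P`_i).-1; rewrite -lead_coefE lead_coef_eq0.
  by apply: contra_neq pi => Pi0; have := Pz i; rewrite Pi0 horner0 => /esym/eqP;
    rewrite mulf_eq0 (negPf qz) => /eqP.
exists (map_poly (fun r : {poly L} => r`_j) P).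
  apply/polyOverP => l; rewrite coef_map_id0 ?coef0 //.
  by move/polyOverP: (PE l); apply.
split; last by rewrite -Qi Q0 coef0.
apply: contra_neq Pij => /(congr1 (fun r : {poly L} => r`_i)).
by rewrite coef_map_id0 ?coef0.
Qed.
End Algebraic.

(** * Exchange along a sequence *)

Section ExchangeSequence.
Variables (L : fieldType) (E : divringClosed L) (B : nat -> Prop) (b z : nat -> L).

Definition seq_field M r :=
  sgen (fun y => [\/ y \in E, exists2 s, (s < M)%N & y = z s
                   | exists2 s, (s < r)%N /\ B s & y = b s]).

Lemma seq_fieldS M r r' : (r <= r')%N -> {subset seq_field M r <= seq_field M r'}.
Proof.
move=> le; apply: sgenS => y [Ey|zy|[s [sr Bs] ->]]; apply: sgen_mem.
- exact: Or31.
- exact: Or32.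
- by apply: Or33; exists s => //; split=> //; apply: leq_trans le.
Qed.

Lemma seq_field_adjoin M r : {subset seq_field M.+1 r <= adjoin (seq_field M r) (z M)}.
Proof.
apply: sgen_min => y [Ey|[s sM ->]|bs].
- by apply/adjoin_sub/sgen_mem; apply: Or31.
- move: sM; rewrite ltnS leq_eqVlt => /predU1P [->|sM]; first exact: adjoin_gen.
  by apply/adjoin_sub/sgen_mem; apply: Or32; exists s.
- by apply/adjoin_sub/sgen_mem; apply: Or33.
Qed.

(** Each z_M can spoil the independence of the b_r only once: if b_(r0) becomes algebraic on
    adjoining z_M, exchange makes z_M algebraic over the field that contains b_(r0), and for r > r0
    adjoining z_M is an algebraic extension, which affects no transcendence. *)
Lemma seq_field_exchange M :
  (forall r, B r -> ~ algebraic_over (seq_field 0 r) (b r)) ->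
  exists R, forall r, (R <= r)%N -> B r -> ~ algebraic_over (seq_field M r) (b r).
Proof.
move=> ind; elim: M => [|M [R hR]]; first by exists 0%N => r _; apply: ind.
have [[r0 [Rr0 Br0 alg0]]|no] := pselect (exists r0, [/\ (R <= r0)%N, B r0 &
    algebraic_over (seq_field M.+1 r0) (b r0)]); last first.
  by exists R => r Rr Br alg; apply: no; exists r.
exists r0.+1 => r r0r Br algr.
have algz : algebraic_over (seq_field M r) (z M).
  have : algebraic_over (adjoin (seq_field M r0) (b r0)) (z M).
    by apply: algebraic_exchange (hR _ Rr0 Br0); apply: algebraic_overS alg0; apply: seq_field_adjoin.
  apply: algebraic_overS; apply: sgen_min => y [|->].
    by apply: seq_fieldS; apply: ltnW.
  by apply: sgen_mem; apply: Or33; exists r0.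
apply: (hR r) => //; first by rewrite (leq_trans Rr0) // ltnW.
apply: (@algebraic_trans _ _ (adjoin (seq_field M r) (z M))).
  by move=> y; apply: algebraic_adjoin.
by apply: algebraic_overS algr; apply: seq_field_adjoin.
Qed.

End ExchangeSequence.

(** * p-independence and Mac Lane's criterion *)

Lemma big_ord_mul (V : nmodType) d p (F : nat -> V) :
  \sum_(l < d * p) F l = \sum_(j < d) \sum_(b < p) F (b + j * p)%N.
Proof.
elim: d F => [|d IHd] F; first by rewrite mul0n !big_ord0.
rewrite big_ord_recl mulSn big_split_ord /=; congr (_ + _).
  by apply: eq_bigr => b _; rewrite mul0n addn0.
rewrite (IHd (fun l => F (p + l)%N)); apply: eq_bigr => j _; apply: eq_bigr => b _.
by rewrite /= mulSn addnCA.
Qed.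

Lemma sum_pair (V : nmodType) (I J : finType) (F : I * J -> V) :
  \sum_ij F ij = \sum_i \sum_j F (i, j).
Proof. by rewrite pair_bigA; apply: eq_bigr => -[]. Qed.

Section PIndependence.
Variables (L : fieldType) (p : nat).
Hypothesis pL : p \in [pchar L].
Implicit Types (k E F : divringClosed L).

Let p_prime : prime p. Proof. exact: pcharf_prime pL. Qed.

(* The minimal polynomial of x would divide X^p - x^p = (X - x)^p, hence be a
   power of X - x of degree less than p, whose derivative contradicts
   minimality. *)
Lemma pth_root_independent E x (r : {poly L}) : x ^+ p \in E -> x \notin E ->
  r \is a polyOver E -> (size r <= p)%N -> r.[x] = 0 -> r = 0.
Proof.
move=> Exp nEx Er sr rx; apply/eqP/negPn/negP => rn.
have [|q Eq [qn qx qmin]] := @algebraic_minpoly _ E x; first by exists r.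
have sq : (size q <= p)%N.
  rewrite (leq_trans _ sr) // leqNgt; apply/negP => /(qmin _ Er) /(_ rx) r0.
  by rewrite r0 eqxx in rn.
have pe : ('X - x%:P) ^+ p = 'X^p - (x ^+ p)%:P :> {poly L}.
  have pLX : p \in [pchar {poly L}] by rewrite pchar_poly.
  have := pFrobenius_autB_comm pLX (mulrC 'X x%:P).
  by rewrite !pFrobenius_autE -polyC_exp.
have qdvd : q %| ('X - x%:P) ^+ p.
  apply/eqP; apply: qmin.
  - by rewrite pe polyOver_modp // polyOverXnsubC.
  - by rewrite ltn_modp.
  - have := divp_eq (('X - x%:P) ^+ p) q; set m := _ %% q.
    move/(congr1 (horner^~ x)); rewrite hornerD hornerM qx mulr0 add0r => <-.
    by rewrite horner_exp hornerXsubC subrr expr0n; case: (p) (prime_gt0 p_prime).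
have q1 : (1 < size q)%N.
  rewrite ltnNge; apply/negP => /size1_polyC qC.
  by move: qx qn; rewrite qC hornerC => ->; rewrite eqxx.
have q'n : q^`() != 0.
  apply/eqP => /(congr1 (fun s : {poly L} => s`_(size q).-2)); rewrite coef_deriv coef0.
  move: q1 sq; case sqE: (size q) => [|[|k]] //= _ sq /eqP.
  rewrite -mulr_natr mulf_eq0 -(dvdn_pcharf pL) => /orP [|/dvdn_leq].
    by apply/negP; rewrite -[k.+1]/(k.+2.-1) -sqE -lead_coefE lead_coef_eq0.
  by move/(_ isT); lia.
have q'x : q^`().[x] != 0.
  apply/eqP => /qmin h; move/eqP: q'n; apply; apply: h; rewrite ?polyOver_deriv //.
  by rewrite lt_size_deriv.
have /dvdp_exp_XsubCP [k [kp qE]] := qdvd.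
have := eqp_size qE; rewrite size_exp_XsubC.
case: k qE {kp} => [|[|k]] qE sqk; first by rewrite sqk in q1.
  have /polyOverP Eq' := Eq.
  have q1n : q`_1 != 0 by move: qn; rewrite -lead_coef_eq0 lead_coefE sqk.
  have q0 : q`_0 = - (q`_1 * x).
    apply/eqP; rewrite -addr_eq0 -[X in _ == X]qx horner_coef sqk !big_ord_recr big_ord0 /=.
    by rewrite add0r expr0 mulr1 expr1.
  case/negP: nEx; have -> : x = - q`_0 / q`_1 by rewrite q0 opprK mulrAC mulfV // mul1r.
  by rewrite rpred_div ?rpredN.
case/eqpP: qE => [[a b]] /= /andP [an bn] qE.
case/negP: q'x; have : (a *: q)^`().[x] = 0.
  rewrite qE derivZ hornerZ deriv_exp derivXsubC mul1r /= hornerMn.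
  by rewrite exprS hornerM hornerXsubC subrr mul0r mul0rn mulr0.
by rewrite derivZ hornerZ => /eqP; rewrite mulf_eq0 (negPf an).
Qed.

(* Mac Lane's criterion, in its symmetric form. *)
Definition pseparable k F := forall (I : finType) (w : I -> L),
  (forall i, w i \in F) ->
  (forall c : I -> L, (forall i, c i \in k) -> \sum_i c i * w i = 0 -> forall i, c i = 0) ->
  forall c : I -> L, (forall i, c i \in k) -> \sum_i c i * w i ^+ p = 0 -> forall i, c i = 0.

(** The field k(F^p). For x in F outside it, the powers 1, x, ..., x^(p-1) are linearly independent
    over it. *)
Definition pclosure k F := sgen (fun y => y \in k \/ exists2 z, z \in F & y = z ^+ p).

(** Sorting the powers of x by exponent modulo p writes the sum as a polynomial in x of degree below
    p over k(F^p), all of whose coefficients must vanish. The coefficient for the residue b is again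
    a sum of p-th powers weighted by elements of k. *)
Lemma pth_power_split k F x (I : finType) (q : I -> {poly L}) (w : I -> L) d :
  x \in F -> x \notin pclosure k F -> (forall i, q i \is a polyOver k) ->
  (forall i, w i \in F) -> (forall i, size (q i) <= d * p)%N ->
  \sum_i (q i).[x] * w i ^+ p = 0 ->
  forall b, (b < p)%N ->
    \sum_(ij : I * 'I_d) (q ij.1)`_(b + ij.2 * p) * (x ^+ ij.2 * w ij.1) ^+ p = 0.
Proof.
move=> Fx nx kq Fw sq sum0 b bp.
pose s b := \sum_(ij : I * 'I_d) (q ij.1)`_(b + ij.2 * p) * (x ^+ ij.2 * w ij.1) ^+ p.
have r0 : \poly_(b < p) s b = 0.
  apply: (@pth_root_independent (pclosure k F) x) => //.
  - by apply: sgen_mem; right; exists x.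
  - apply: polyOver_poly => c _; apply: rpred_sum => -[i j] _ /=; apply: rpredM.
      by apply: sgen_mem; left; move/polyOverP: (kq i); apply.
    by apply: sgen_mem; right; exists (x ^+ j * w i); rewrite ?rpredM ?rpredX.
  rewrite horner_poly -[RHS]sum0.
  rewrite (eq_bigr (fun b : 'I_p => \sum_i \sum_(j < d)
     (q i)`_(b + j * p) * x ^+ (b + j * p) * w i ^+ p)); last first.
    move=> c _; rewrite /s sum_pair /=.
    rewrite mulr_suml; apply: eq_bigr => i _; rewrite mulr_suml; apply: eq_bigr => j _.
    by rewrite exprMn -exprM exprD -!mulrA; congr (_ * _); rewrite mulrA [RHS]mulrC.
  rewrite exchange_big /=; apply: eq_bigr => i _.
  rewrite (horner_coef_wide x (sq i)) (big_ord_mul _ _ (fun l => (q i)`_l * x ^+ l)).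
  rewrite exchange_big /= mulr_suml; apply: eq_bigr => j _.
  by rewrite mulr_suml.
by have := congr1 (fun r : {poly L} => r`_b) r0; rewrite coef_poly bp coef0.
Qed.

(** For a minimal polynomial q of x, splitting q(x) = 0 by residues modulo p gives relations between
    the p-th powers of the x^j, j < deg q. These x^j are independent over k, so separability kills
    every coefficient of q. *)
Lemma pseparable_transcendental k F x : pseparable k F ->
  x \in F -> x \notin pclosure k F -> ~ algebraic_over k x.
Proof.
move=> sepkF Fx nx /algebraic_minpoly [q kq [qn qx qmin]].
have q1 : (1 < size q)%N.
  rewrite ltnNge; apply/negP => /size1_polyC qC.
  by move: qx qn; rewrite qC hornerC => ->; rewrite eqxx.
have p1 := prime_gt1 p_prime.
(* The degree of q: the largest range in which the x^j, j < d, are independent over k. It suffices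
   because d + 1 <= d * p for d >= 1 and p >= 2. *)
pose d := (size q).-1.
have sq : (size q <= d * p)%N by rewrite /d; nia.
have split0 := @pth_power_split k F x unit (fun=> q) (fun=> 1) d Fx nx
  (fun=> kq) (fun=> rpred1 _) (fun=> sq).
case/eqP: qn; apply/polyP => l; rewrite coef0.
have [lt_l|?] := ltnP l (d * p); last by rewrite nth_default // (leq_trans sq).
have jd : (l %/ p < d)%N by rewrite ltn_divLR // prime_gt0.
have lp : (l %% p < p)%N by rewrite ltn_mod prime_gt0.
have {split0} := split0 _ _ lp.
rewrite big_const cardT enumT unlock /= qx mul0r addr0 => /(_ erefl) s0.
have := sepkF (unit * 'I_d)%type (fun ij => x ^+ ij.2 * 1) _ _ _ _ s0 (tt, Ordinal jd).
rewrite /= addnC -divn_eq; apply.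
- by move=> ij; rewrite mulr1 rpredX.
- move=> c kc c0 [[] j].
  have := qmin (\poly_(j < d) oapp (fun j => c (tt, j)) 0 (insub j : option 'I_d)).
  move=> /(_ _ _ _)/(congr1 (fun r : {poly L} => r`_j)).
  rewrite coef_poly ltn_ord coef0 valK /=; apply.
  + by apply: polyOver_poly => i _; case: (insub i : option 'I_d) => [i'|] /=; rewrite ?rpred0.
  + by rewrite (leq_ltn_trans (size_poly _ _)) // /d ltn_predL ltnW.
  rewrite horner_poly -[RHS]c0.
  rewrite sum_pair /=.
  rewrite (big_pred1 tt) /=; last by case.
   apply: eq_bigr => i _.
  by rewrite valK mulr1.
- by move=> ij; move/polyOverP: kq; apply.
Qed.

(** A relation over k(x), cleared of denominators, splits by residues modulo p into relations over k
    between the p-th powers of the x^j w_i. These products are independent over k because x is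
    transcendental over k and the w_i are independent over k(x). *)
Lemma pseparable_adjoin k F x : pseparable k F ->
  x \in F -> x \notin pclosure k F -> pseparable (adjoin k x) F.
Proof.
move=> sepkF Fx nx I w Fw indw c kc c0.
have trx := pseparable_transcendental sepkF Fx nx.
have [q [kq qx] [u ku uE]] := @adjoinD _ k x #|I| (fun i => c (enum_val i)) (fun i => kc _).
pose v i := u (enum_rank i).
have vE i : q.[x] * c i = (v i).[x] by rewrite /v -uE enum_rankK.
have kv i : v i \is a polyOver k by apply: ku.
pose d := (\max_i size (v i))%N.
have sv i : (size (v i) <= d * p)%N.
  have : (size (v i) <= d)%N by apply: (@leq_bigmax _ (fun i => size (v i)) i).
  by have := prime_gt0 p_prime; nia.
have v0 : \sum_i (v i).[x] * w i ^+ p = 0.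
  by rewrite -[RHS](mulr0 q.[x]) -[in RHS]c0 mulr_sumr; apply: eq_bigr => i _; rewrite -vE mulrA.
have split0 := pth_power_split Fx nx kv Fw sv v0.
move=> i; apply: (mulfI qx); rewrite mulr0 vE.
suff -> : v i = 0 by rewrite horner0.
apply/polyP => l; rewrite coef0.
have [lt_l|?] := ltnP l (d * p); last by rewrite nth_default // (leq_trans (sv i)).
have jd : (l %/ p < d)%N by rewrite ltn_divLR // prime_gt0.
have lp : (l %% p < p)%N by rewrite ltn_mod prime_gt0.
have := sepkF (I * 'I_d)%type (fun ij => x ^+ ij.2 * w ij.1) _ _ _ _ (split0 _ lp) (i, Ordinal jd).
rewrite /= addnC -divn_eq; apply.
- by move=> ij; rewrite rpredM ?rpredX.
- move=> a ka a0 [i' j'].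
  pose r i := \poly_(j < d) oapp (fun j => a (i, j)) 0 (insub j : option 'I_d).
  have kr i'' : r i'' \is a polyOver k.
    by apply: polyOver_poly => j _; case: (insub j : option 'I_d) => [?|] /=; rewrite ?rpred0.
  have rx0 i'' : (r i'').[x] = 0.
    apply: (indw (fun i => (r i).[x])).
      move=> i3; rewrite rpred_horner ?adjoin_gen //; apply: polyOverS (kr i3).
      exact: adjoin_sub.
    rewrite -[RHS]a0 sum_pair /=.
    apply: eq_bigr => i3 _; rewrite horner_poly mulr_suml; apply: eq_bigr => j _.
    by rewrite valK mulrA.
  have r0 : r i' = 0.
    by apply/eqP/negPn/negP => rn; apply: trx; exists (r i').
  by have := congr1 (fun s : {poly L} => s`_j') r0; rewrite coef_poly ltn_ord coef0 valK.
- by move=> ij; move/polyOverP: (kv ij.1); apply.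
Qed.

End PIndependence.

(** * Derivations and generated subrings *)

Section Derivation.
Variables (R : comNzRingType) (d : R -> R).
Hypothesis dd : derivation d.

Lemma derivationD x y : d (x + y) = d x + d y. Proof. exact: dd.1. Qed.
Lemma derivationM x y : d (x * y) = d x * y + x * d y. Proof. exact: dd.2. Qed.
Lemma derivation0 : d 0 = 0.
Proof. by apply: (addIr (d 0)); rewrite -derivationD !add0r. Qed.
Lemma derivation1 : d 1 = 0.
Proof. by apply: (addIr (d 1)); rewrite add0r -[in RHS](mulr1 1) derivationM mulr1 mul1r. Qed.
Lemma derivationN x : d (- x) = - d x.
Proof. by apply: (addIr (d x)); rewrite -derivationD !addNr derivation0. Qed.
Lemma derivationB x y : d (x - y) = d x - d y.
Proof. by rewrite derivationD derivationN. Qed.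
Lemma derivationX x m : d (x ^+ m) = x ^+ m.-1 * d x *+ m.
Proof.
elim: m => [|[|m] IHm]; first by rewrite derivation1 mulr0n.
  by rewrite expr1 mul1r.
by rewrite exprS derivationM IHm /= mulrnAr mulrA -exprS mulrC -mulrS.
Qed.

Lemma derivation_horner (Q : {poly R}) x :
  d Q.[x] = (map_poly d Q).[x] + Q^`().[x] * d x.
Proof.
elim/poly_ind: Q => [|Q c IHQ].
  by rewrite deriv0 map_poly0 !horner0 derivation0 mul0r addr0.
rewrite hornerMXaddC derivationD derivationM IHQ derivMXaddC !hornerE.
have -> : map_poly d (Q * 'X + c%:P) = map_poly d Q * 'X + (d c)%:P.
  apply/polyP => i; rewrite coef_map_id0 ?derivation0 // !coefD !coefMX !coefC derivationD.
  by case: i => [|i] /=; rewrite ?coef_map_id0 ?derivation0.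
rewrite !hornerE; ring.
Qed.
End Derivation.

Lemma derivation_div (F : fieldType) (d : F -> F) : derivation d -> forall x y,
  d (x / y) = (d x * y - x * d y) / y ^+ 2.
Proof.
move=> dd x y; have [->|yn] := eqVneq y 0.
  by rewrite invr0 mulr0 expr0n invr0 mulr0 (derivation0 dd).
apply: (mulIf yn); apply: (addIr (x / y * d y)).
by rewrite -(derivationM dd) divfK //; field.
Qed.

Section GeneratedSubring.
Variable R : comNzRingType.
Implicit Types (S Q : R -> Prop).

Definition rgen S : {pred R} :=
  fun x => `[< forall A : subringClosed R, (forall y, S y -> y \in A) -> x \in A >].

Fact rgen_closed S : subring_closed (rgen S).
Proof.
split=> [|x y /asboolP hx /asboolP hy|x y /asboolP hx /asboolP hy]; apply/asboolP => F hF.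
- exact: rpred1.
- by rewrite rpredB ?hx ?hy.
- by rewrite rpredM ?hx ?hy.
Qed.

HB.instance Definition _ S := GRing.isSubringClosed.Build R (rgen S) (rgen_closed S).

Lemma rgen_mem S y : S y -> y \in rgen S.
Proof. by move=> Sy; apply/asboolP => F; apply. Qed.

Definition rpropset Q : {pred R} := fun x => `[< Q x >].

Lemma rgen_ind S Q : Q 1 -> (forall x y, Q x -> Q y -> Q (x - y)) ->
  (forall x y, Q x -> Q y -> Q (x * y)) -> (forall y, S y -> Q y) ->
  forall x, x \in rgen S -> Q x.
Proof.
move=> Q1 QB QM SQ x.
have cl : subring_closed (rpropset Q).
  by split=> [|y z /asboolP hy /asboolP hz|y z /asboolP hy /asboolP hz];
    apply/asboolP; auto.
pose A : subringClosed R :=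
  HB.pack (rpropset Q) (GRing.isSubringClosed.Build R (rpropset Q) cl).
move=> /asboolP /(_ A) h.
by apply/asboolP/h => y /SQ Qy; apply/asboolP.
Qed.

Lemma rgenS S S' : (forall x, S x -> x \in rgen S') -> {subset rgen S <= rgen S'}.
Proof.
move=> SS'; apply: rgen_ind => //; first exact: rpred1.
  by move=> x y ? ?; apply: rpredB.
by move=> x y ? ?; apply: rpredM.
Qed.
End GeneratedSubring.

(** * Mac Lane's condition over the base field *)

Section BaseSeparable.
Variables (K L : fieldType) (iota : {rmorphism K -> L}).

Definition base_field : {pred L} := fun y => `[< exists c, y = iota c >].
Fact base_field_closed : divring_closed base_field.
Proof.
split=> [|x y /asboolP [a ->] /asboolP [b ->]|x y /asboolP [a ->] /asboolP [b ->]];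
  apply/asboolP.
- by exists 1; rewrite rmorph1.
- by exists (a - b); rewrite rmorphB.
- by exists (a / b); rewrite fmorph_div.
Qed.
HB.instance Definition _ := GRing.isDivringClosed.Build L base_field base_field_closed.

Lemma base_fieldP y : reflect (exists c, y = iota c) (y \in base_field).
Proof. exact: asboolP. Qed.

(* The relation sum_i c_i w_i^p = 0 is rewritten over a K^p-basis of the span of
   the c_i, where Mac Lane's condition applies. *)
Lemma separable_pseparable p (F : divringClosed L) : p \in [pchar K] ->
  separable_ext iota -> pseparable p base_field F.
Proof.
move=> pK sepL I w Fw indw c kc c0.
have pL : p \in [pchar L] by rewrite (fmorph_pchar iota).
have p0 : (0 < p)%N by rewrite prime_gt0 // (pcharf_prime pL).
have frob (J : finType) (x : J -> L) : (\sum_j x j) ^+ p = \sum_j x j ^+ p.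
  by have := rmorph_sum (pFrobenius_aut pL) (index_enum J) xpredT x.
pose K' (y : L) := exists a : K, y = iota a.
pose indS (S : {set I}) := `[< forall d : I -> L, (forall i, powers p K' (d i)) ->
  \sum_(i in S) d i * c i = 0 -> forall i, i \in S -> d i = 0 >].
have ind0 : indS set0 by apply/asboolP => d _ _ i; rewrite inE.
have [S /maxsetP [/asboolP indSS maxS] _] := maxset_exists ind0.
have [a a_p cE] : exists2 a : I -> I -> L, (forall i j, powers p K' (a i j)) &
    forall i, c i = \sum_(j in S) a i j * c j.
  suff /choice [a ha] : forall i, exists a : I -> L, (forall j, powers p K' (a j)) /\
      c i = \sum_(j in S) a j * c j.
    by exists a => [i j|i]; [apply: (ha i).1 | apply: (ha i).2].
  have pK'0 : powers p K' 0 by exists 0; [exists 0; rewrite rmorph0 | rewrite expr0n; case: (p) p0].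
  have pK'1 : powers p K' 1 by exists 1; [exists 1; rewrite rmorph1 | rewrite expr1n].
  move=> i; have [iS|niS] := boolP (i \in S).
    exists (fun j => (i == j)%:R); split=> [j|]; first by case: eqP.
    rewrite (bigD1 i) //= eqxx mul1r big1 ?addr0 // => j /andP [_ /negPf].
    by rewrite eq_sym => ->; rewrite mul0r.
  have : ~~ indS (i |: S).
    apply/negP => /maxS /(_ (subsetUr _ _)) eS.
    by case/negP: niS; rewrite -eS setU11.
  move/asboolPn => /existsNP [d] /not_implyP [dp] /not_implyP [d0] /existsNP [j] /not_implyP [jS dj].
  move: d0; rewrite big_setU1 //= => d0.
  have di : d i != 0.
    apply/eqP => di0; apply: dj; move: jS; rewrite !inE => /predU1P [-> //|jS].
    by apply: indSS => //; rewrite -[RHS]d0 di0 mul0r add0r.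
  exists (fun j => - (d j / d i)); split=> [l|].
    have [x [u ->] ->] := dp l; have [y [v ->] ->] := dp i.
    exists (iota (- (u / v))); first by exists (- (u / v)).
    by rewrite rmorphN fmorph_div -!(pFrobenius_autE pL) rmorphN fmorph_div.
  apply: (mulfI di); rewrite mulr_sumr (eq_bigr (fun j => - (d j * c j))).
    by rewrite sumrN; apply/eqP; rewrite -addr_eq0 d0.
  by move=> l _; rewrite mulrA mulrN mulrC mulrN [d i * _]mulrC divfK // mulrC.
have [al alK alE] : exists2 al : I -> I -> L, (forall i j, al i j \in base_field) &
    forall i j, a i j = al i j ^+ p.
  suff /choice [al hal] : forall i, exists al : I -> L, forall j, al j \in base_field /\ a i j = al j ^+ p.
    by exists al => i j; have [] := hal i j.
  move=> i; suff /choice [al hal] : forall j, exists x, x \in base_field /\ a i j = x ^+ p.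
    by exists al.
  by move=> j; have [x [u ->] ->] := a_p i j; exists (iota u); split=> //; apply/base_fieldP; exists u.
have sum0 : \sum_(j in S) (\sum_i al i j * w i) ^+ p * c j = 0.
  rewrite -[RHS]c0.
  under eq_bigr do rewrite frob mulr_suml.
  rewrite exchange_big /=; apply: eq_bigr => i _; rewrite [in RHS]cE mulr_suml.
  by apply: eq_bigr => j _; rewrite exprMn -alE mulrAC.
have al0 i j : j \in S -> al i j = 0.
  move=> jS; apply: (indw (fun i => al i j)) => //.
  have := sepL p pK #|S| (fun j => c (enum_val j)) _ _ (fun j => (\sum_i al i (enum_val j) * w i) ^+ p) _ _ (enum_rank_in jS j).
  rewrite enum_rankK_in // => h.
  have /eqP : (\sum_i0 al i0 j * w i0) ^+ p = 0.
    apply: h => [j'|d dp d0 j'|j'|].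
    - by have /base_fieldP := kc (enum_val j').
    - have := indSS (fun i => d (enum_rank_in jS i)) _ _ _ (enum_valP j').
      rewrite enum_valK_in; apply=> //.
      by rewrite -[RHS]d0 big_enum_val; apply: eq_bigr => l _; rewrite enum_valK_in.
    - by exists (\sum_i al i (enum_val j') * w i).
    - by rewrite -[RHS]sum0 [RHS]big_enum_val.
  by rewrite expf_eq0 p0 => /eqP.
move=> i; rewrite cE big1 // => j jS; rewrite alE al0 // expr0n.
by case: (p) p0 => // ? _; rewrite mul0r.
Qed.
End BaseSeparable.

(** * Prolongation sequences *)

(** Eliminating leading terms only multiplies by leading coefficients, so everything stays over [A].
    The power of the leading coefficient of [Q] is cancelled later, in a field where its image is
    nonzero. *)
Lemma pseudo_division (R : comNzRingType) (A : subringClosed R) (Q P : {poly R}) :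
  Q != 0 -> Q \is a polyOver A -> P \is a polyOver A ->
  exists k P1 P2, [/\ P1 \is a polyOver A, P2 \is a polyOver A, (size P2 < size Q)%N &
    lead_coef Q ^+ k *: P = P1 * Q + P2].
Proof.
move=> Qn AQ; have [s] := ubnP (size P); elim: s P => // s IHs P; rewrite ltnS => sP AP.
have [lt_PQ|le_QP] := ltnP (size P) (size Q).
  by exists 0%N, 0, P; rewrite rpred0 expr0 scale1r mul0r add0r.
have Al : lead_coef Q \in A by move/polyOverP: AQ; apply.
have AlP : lead_coef P \in A by move/polyOverP: AP; apply.
pose m := (size P - size Q)%N.
pose P' := lead_coef Q *: P - (lead_coef P *: 'X^m) * Q.
have AX : lead_coef P *: 'X^m \is a polyOver A by rewrite polyOverZ ?rpredX ?polyOverX.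
have AP' : P' \is a polyOver A by apply: rpredB; [apply: polyOverZ | apply: rpredM].
have Q0 : (0 < size Q)%N by rewrite size_poly_gt0.
have sP' : (size P' < s)%N.
  apply: leq_trans sP; rewrite -(ltn_predK (leq_trans Q0 le_QP)) ltnS; apply/leq_sizeP => j hj.
  rewrite coefB coefZ -scalerAl coefZ coefXnM.
  have -> : (j < m)%N = false by apply/negbTE; rewrite -leqNgt; move: hj le_QP Q0; rewrite /m; lia.
  have [->|jn] := eqVneq j (size P).-1.
    rewrite -lead_coefE (_ : ((size P).-1 - m)%N = (size Q).-1); last by move: le_QP Q0; rewrite /m; lia.
    by rewrite -lead_coefE mulrC subrr.
  have hj' : (size P <= j)%N by move: hj jn le_QP Q0; lia.
  rewrite !nth_default ?mulr0 ?subrr //.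
  have aux (a b l : nat) : (b <= a)%N -> (a <= l)%N -> (b <= l - (a - b))%N by lia.
  exact: aux.
have [k [P1 [P2 [AP1 AP2 sP2 eq2]]]] := IHs _ sP' AP'.
exists k.+1, (P1 + lead_coef Q ^+ k *: (lead_coef P *: 'X^m)), P2; split=> //.
  by rewrite rpredD // polyOverZ ?rpredX.
rewrite exprSr -scalerA -[lead_coef Q *: P](subrK ((lead_coef P *: 'X^m) * Q)) -/P' scalerDr eq2.
by rewrite mulrDl addrAC; congr (_ + _ + _); rewrite scalerAl.
Qed.

Section RestrictBase.
Variables (K L : fieldType) (iota : {rmorphism K -> L}) (E : divringClosed L).
Hypothesis KE : forall c, iota c \in E.

Definition restrict_base c : subfield_type E := Sub (iota c) (KE c).

Fact restrict_base_zmod : zmod_morphism restrict_base.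
Proof. by move=> x y; apply: val_inj; rewrite /= rmorphB. Qed.
Fact restrict_base_monoid : monoid_morphism restrict_base.
Proof. by split=> [|x y]; apply: val_inj; rewrite /= ?rmorph1 ?rmorphM. Qed.
HB.instance Definition _ :=
  GRing.isZmodMorphism.Build K (subfield_type E) restrict_base restrict_base_zmod.
HB.instance Definition _ :=
  GRing.isMonoidMorphism.Build K (subfield_type E) restrict_base restrict_base_monoid.
End RestrictBase.

Section Prolongation.
Variables (K : diffField) (R : comNzRingType) (C : {rmorphism K -> R}) (d : R -> R).
Hypotheses (dd : derivation d) (dC : forall c, d (C c) = C (der c)).
Variables (n : nat) (X : nat -> R).
Hypotheses (n_gt0 : (0 < n)%N) (dX : forall r, d (X r) = X (r + n)%N).

(** The subring K[X_s : s < r]. The X_s may satisfy relations in [R]: the enumeration [dpoly_var]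
    contains zeros. *)
Definition Pol r : {pred R} :=
  rgen (fun f => (exists c, f = C c) \/ exists2 s, (s < r)%N & f = X s).
HB.instance Definition _ r := GRing.SubringClosed.on (Pol r).

Lemma PolC r c : C c \in Pol r.
Proof. by apply: rgen_mem; left; exists c. Qed.

Lemma PolX r s : (s < r)%N -> X s \in Pol r.
Proof. by move=> sr; apply: rgen_mem; right; exists s. Qed.

Lemma PolS r r' : (r <= r')%N -> {subset Pol r <= Pol r'}.
Proof.
move=> le; apply: rgenS => f [[c ->]|[s sr ->]]; first exact: PolC.
by apply: PolX; apply: leq_trans le.
Qed.

Lemma Pol_der r f : f \in Pol r -> d f \in Pol (r + n).
Proof.
suff : f \in Pol r -> f \in Pol (r + n) /\ d f \in Pol (r + n) by move=> h /h [].
move: f; apply: rgen_ind => [|x y [? ?] [? ?]|x y [? ?] [? ?]|y [[c ->]|[s sr ->]]].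
- by rewrite (derivation1 dd) rpred0 rpred1.
- by rewrite (derivationB dd) !rpredB.
- by rewrite (derivationM dd) rpredD ?rpredM.
- by rewrite dC !PolC.
- by rewrite dX !PolX // ?ltn_add2r // ltn_addr.
Qed.

Lemma Pol_succ r f : f \in Pol r.+1 ->
  exists2 Q : {poly R}, Q \is a polyOver (Pol r) & f = Q.[X r].
Proof.
move: f; apply: rgen_ind => [|_ _ [P hP ->] [Q hQ ->]|_ _ [P hP ->] [Q hQ ->]|y [[c ->]|[s sr ->]]].
- by exists 1; rewrite ?rpred1 ?hornerE.
- by exists (P - Q); rewrite ?rpredB ?hornerE.
- by exists (P * Q); rewrite ?rpredM ?hornerE.
- by exists (C c)%:P; rewrite ?polyOverC ?PolC ?hornerE.
- move: sr; rewrite ltnS leq_eqVlt => /predU1P [->|sr].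
    by exists 'X; rewrite ?polyOverX ?hornerE.
  by exists (X s)%:P; rewrite ?polyOverC ?PolX ?hornerE.
Qed.

Lemma Pol_horner r (Q : {poly R}) : Q \is a polyOver (Pol r) -> Q.[X r] \in Pol r.+1.
Proof.
move=> hQ; rewrite rpred_horner ?PolX //; apply: polyOverS hQ; exact: PolS.
Qed.

(* Past the first derivative, a relation is linear in its leader, and the
   coefficient of the leader is always the separant of the initial relation. *)
Lemma separant_iter r (Q : {poly R}) k : Q \is a polyOver (Pol r) ->
  exists2 f, f \in Pol (r + k.+1 * n) &
    iter k.+1 d Q.[X r] = Q^`().[X r] * X (r + k.+1 * n)%N + f.
Proof.
move=> hQ; have hQ' : Q^`().[X r] \in Pol r.+1 by apply/Pol_horner; rewrite polyOver_deriv.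
elim: k => [|k [f hf IHk]].
  exists (map_poly d Q).[X r]; last by rewrite /= (derivation_horner dd) dX mul1n addrC.
  rewrite mul1n; apply: rpred_horner; last by apply: PolX; lia.
  apply/polyOverP => i; rewrite coef_map_id0 ?(derivation0 dd) //.
  by apply: Pol_der; move/polyOverP: hQ; apply.
exists (d Q^`().[X r] * X (r + k.+1 * n)%N + d f).
  rewrite rpredD ?rpredM //.
  - by apply: (PolS _ (Pol_der hQ')); nia.
  - by apply: PolX; nia.
  - by apply: (PolS _ (Pol_der hf)); nia.
rewrite iterS IHk (derivationD dd) (derivationM dd) dX.
have -> : (r + k.+1 * n + n = r + k.+2 * n)%N by nia.
by rewrite -addrA addrCA.
Qed.

(** * The tower of stages, leaders and free indices *)

Variables (L : diffExt K) (eps : {rmorphism R -> L}).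
Hypotheses (epsC : forall c, eps (C c) = de_inj L c)
           (eps_der : forall f, eps (d f) = der (eps f)).

Let derL := @der_derivation L.
Definition gen_pt r := eps (X r).
Local Notation e := gen_pt.
Local Notation K0 := (base_field (de_inj L)).

Definition stage r : {pred L} :=
  sgen (fun y => y \in K0 \/ exists2 s, (s < r)%N & y = e s).
HB.instance Definition _ r := GRing.DivringClosed.on (stage r).
Local Notation E := stage.

Lemma der_pt r : der (e r) = e (r + n). Proof. by rewrite /gen_pt -eps_der dX. Qed.

Lemma stage_base r : {subset K0 <= E r}.
Proof. by move=> x ?; apply: sgen_mem; left. Qed.

Lemma stage_pt r s : (s < r)%N -> e s \in E r.
Proof. by move=> sr; apply: sgen_mem; right; exists s. Qed.

Lemma stageS r r' : (r <= r')%N -> {subset E r <= E r'}.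
Proof.
move=> le; apply: sgenS => y [?|[s sr ->]]; first exact: stage_base.
by apply: stage_pt; apply: leq_trans le.
Qed.

Lemma stage_eps r f : f \in Pol r -> eps f \in E r.
Proof.
move: f; apply: rgen_ind => [|x y ? ?|x y ? ?|y [[c ->]|[s sr ->]]].
- by rewrite rmorph1 rpred1.
- by rewrite rmorphB rpredB.
- by rewrite rmorphM rpredM.
- by apply: stage_base; apply/base_fieldP; exists c; rewrite epsC.
- exact: stage_pt.
Qed.

Lemma stage_frac r x : x \in E r ->
  exists f g, [/\ f \in Pol r, g \in Pol r, eps g != 0 & x = eps f / eps g].
Proof.
move: x; apply: sgen_ind.
- by exists 1, 1; rewrite rpred1 rmorph1 oner_eq0 divr1.
- move=> _ _ [p1 [q1 [Ep1 Eq1 n1 ->]]] [p2 [q2 [Ep2 Eq2 n2 ->]]].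
  exists (p1 * q2 - p2 * q1), (q1 * q2).
  rewrite rpredB ?rpredM // rmorphB !rmorphM mulf_neq0 //.
  by split=> //; field; rewrite n1 n2.
- move=> _ _ [p1 [q1 [Ep1 Eq1 n1 ->]]] [p2 [q2 [Ep2 Eq2 n2 ->]]].
  have [p20|p20] := eqVneq (eps p2) 0.
    by exists 0, 1; rewrite p20 mul0r invr0 mulr0 rpred0 rpred1 rmorph0 rmorph1 oner_eq0 mul0r.
  exists (p1 * q2), (q1 * p2); rewrite !rpredM // !rmorphM mulf_neq0 //.
  by split=> //; rewrite invf_div mulf_div.
- move=> y [/base_fieldP [c ->]|[s sr ->]].
    by exists (C c), 1; rewrite PolC rpred1 rmorph1 oner_eq0 divr1 epsC.
  by exists (X s), 1; rewrite PolX // rpred1 rmorph1 oner_eq0 divr1.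
Qed.

Lemma stage_poly r (q : {poly L}) : q \is a polyOver (E r) ->
  exists2 g, g \in Pol r /\ eps g != 0 &
  exists2 Q : {poly R}, Q \is a polyOver (Pol r) & map_poly eps Q = eps g *: q.
Proof.
elim/poly_ind: q => [|q c IHq] hq.
  exists 1; first by rewrite rpred1 rmorph1 oner_eq0.
  by exists 0; rewrite ?rpred0 // map_poly0 scaler0.
have [hq1 hc] : q \is a polyOver (E r) /\ c \in E r.
  move/polyOverP: hq => hq; split.
    by apply/polyOverP => i; have := hq i.+1; rewrite coefD coefMX coefC addr0.
  by have := hq 0%N; rewrite coefD coefMX coefC add0r.
have [g [hg gn] [Q hQ QE]] := IHq hq1.
have [f1 [g1 [hf1 hg1 g1n cE]]] := stage_frac hc.
exists (g * g1); first by rewrite rpredM // rmorphM mulf_neq0.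
exists ((g1 *: Q) * 'X + (g * f1)%:P).
  by rewrite rpredD ?rpredM ?polyOverX ?polyOverC ?rpredM ?polyOverZ.
rewrite rmorphD /= [map_poly eps (_ * _)]rmorphM /= map_polyX map_polyC /= map_polyZ /= QE !rmorphM /=.
rewrite scalerDr scalerA [eps g1 * _]mulrC -scalerAl cE; congr (_ + _).
by rewrite -mul_polyC -!polyCM; congr (_%:P); field.
Qed.

Definition sep_stage r := sepalgebraic_over (E r) (e r).

Lemma sep_stageP r : sep_stage r -> exists2 Q : {poly R}, Q \is a polyOver (Pol r) &
  eps Q.[X r] = 0 /\ eps Q^`().[X r] != 0.
Proof.
move=> [q hq [qe q'e]]; have [g [hg gn] [Q hQ QE]] := stage_poly hq.
exists Q => //; rewrite -!horner_map /= -deriv_map /= QE derivZ !hornerZ qe mulr0.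
by rewrite mulf_neq0.
Qed.

(** Differentiating the relation of e_r k + 1 times leaves an equation linear in the new derivative,
    whose coefficient is the nonvanishing separant; it can be solved. *)
Lemma sep_stage_mem r k : sep_stage r -> e (r + k.+1 * n) \in E (r + k.+1 * n).
Proof.
move=> /sep_stageP [Q hQ [Q0 Q'n]].
have [f hf fE] := separant_iter k hQ.
have hQ' : Q^`().[X r] \in Pol r.+1 by apply/Pol_horner; rewrite polyOver_deriv.
have : eps (iter k.+1 d Q.[X r]) = 0.
  elim: (k.+1) => //= j IHj; first by rewrite eps_der IHj (derivation0 derL).
rewrite fE rmorphD rmorphM /= => /eqP; rewrite addr_eq0 => /eqP eE.
have -> : e (r + k.+1 * n) = - eps f / eps Q^`().[X r].
  by rewrite -eE mulrC mulKf.
rewrite rpred_div ?rpredN ?stage_eps //.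
by apply: (PolS _ hQ'); nia.
Qed.

Definition free_index r := forall k, ~ sep_stage (r %% n + k * n).

Lemma free_not r : free_index r -> ~ sep_stage r.
Proof. by move=> /(_ (r %/ n)%N); rewrite addnC -divn_eq. Qed.

Lemma freeD r k : free_index (r + k * n) <-> free_index r.
Proof. by rewrite /free_index -modnDmr modnMl addn0. Qed.

(** A residue class modulo n that contains a leader consists of leaders from some point on, and
    there are only n classes, so one bound serves all. *)
Lemma free_or_sep : exists M, forall r, (M <= r)%N -> ~ free_index r -> sep_stage r.
Proof.
have /choice [m hm] : forall i, exists m, forall k, (m <= k)%N -> ~ free_index i -> sep_stage (i %% n + k * n).
  move=> i; have [fi|] := pselect (free_index i); first by exists 0%N.
  move/existsNP => [k /contrapT hk]; exists k.+1 => l kl _.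
  apply: mem_sepalgebraic; have := @sep_stage_mem _ (l - k.+1) hk.
  by have -> : (i %% n + k * n + (l - k.+1).+1 * n = i %% n + l * n)%N by nia.
exists ((\max_(i < n) m i).+1 * n)%N => r Mr nf.
have in_ : (r %% n < n)%N by rewrite ltn_mod.
have := hm (r %% n)%N (r %/ n)%N; rewrite modn_mod addnC -divn_eq; apply; last first.
  by rewrite /free_index modn_mod.
have := @leq_bigmax _ (fun i : 'I_n => m i) (Ordinal in_) => /= h; rewrite (leq_trans h) //.
by rewrite leq_divRL //; apply: leq_trans Mr; rewrite leq_mul2r leqnSn orbT.
Qed.

(** * Algebraic independence of the free generators *)

Section Separable.
Hypothesis sepL : separable_ext (de_inj L).

(** The argument [0] adjoins none of the auxiliary elements, so this is K(e_s : s < r, s free). *)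
Definition free_field r := seq_field K0 free_index e e 0 r.

Lemma free_field_stage r : {subset free_field r <= E r}.
Proof.
by apply: sgen_min => y [?|[s]|[s [sr _] ->]] //; [apply: stage_base | apply: stage_pt].
Qed.

Lemma free_fieldS r : free_index r -> free_field r.+1 =i adjoin (free_field r) (e r).
Proof.
move=> fr x; apply/idP/idP; move: x; apply: sgen_min.
  move=> y [?|[s]|[s [sr fs] ->]] //.
    by apply/adjoin_sub/sgen_mem; apply: Or31.
  move: sr; rewrite ltnS leq_eqVlt => /predU1P [->|sr]; first exact: adjoin_gen.
  by apply/adjoin_sub/sgen_mem; apply: Or33; exists s.
move=> y [|->]; first by apply: seq_fieldS.
by apply: sgen_mem; apply: Or33; exists r.
Qed.

Lemma free_fieldN r : ~ free_index r -> free_field r.+1 =i free_field r.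
Proof.
move=> fr x; apply/idP/idP; last by apply: seq_fieldS.
move: x; apply: sgen_min => y [?|[s]|[s [sr fs] ->]] //.
  by apply/sgen_mem; apply: Or31.
move: sr; rewrite ltnS leq_eqVlt => /predU1P [sr|sr]; first by rewrite sr in fs.
by apply/sgen_mem; apply: Or33; exists s.
Qed.

Lemma eq_pseparable p (k1 k2 F : divringClosed L) : k1 =i k2 ->
  pseparable p k1 F -> pseparable p k2 F.
Proof.
move=> k12 sep I w Fw ind c kc c0; apply: (sep I w) => // [a ka|i].
  by apply: ind => i; rewrite -k12.
by rewrite k12.
Qed.

(* p-th powers are constants, so applying the derivation to e_l \in A(l) gives
   e_(l+n) \in A(l+n), and beyond r0 the field A(l) is just E(l). *)
Lemma free_pindependent p r0 l : p \in [pchar L] -> free_index l -> (l <= r0)%N ->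
  e l \notin pclosure p (free_field l) (free_field r0.+1).
Proof.
move=> pL fl lr0.
pose A m := sgen (fun y => [\/ y \in K0, exists2 s, (s < m)%N & y = e s
                           | exists2 s, (s <= r0)%N & y = e s ^+ p]).
have AS m m' : (m <= m')%N -> {subset A m <= A m'}.
  move=> le; apply: sgenS => y [Ey|[s sr ->]|zy]; apply: sgen_mem.
  - exact: Or31.
  - by apply: Or32; exists s => //; apply: leq_trans le.
  - exact: Or33.
have derA m x : x \in A m -> der x \in A (m + n)%N.
  suff : x \in A m -> x \in A (m + n)%N /\ der x \in A (m + n)%N by move=> h /h [].
  move: x; apply: sgen_ind => [|x y [? ?] [? ?]|x y [? ?] [? ?]|y [|[s sm ->]|[s sr ->]]].
  - by rewrite (derivation1 derL) rpred0 rpred1.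
  - by rewrite (derivationB derL) !rpredB.
  - by rewrite (derivation_div derL) !rpred_div ?rpredB ?rpredM ?rpredX.
  - move=> /base_fieldP [c ->]; rewrite -de_injE.
    by split; apply/sgen_mem/Or31/base_fieldP; [exists c | exists (der c)].
  - rewrite der_pt; split; apply/sgen_mem/Or32; [exists s|exists (s + n)%N] => //; lia.
  - split; first by apply/sgen_mem/Or33; exists s.
    by rewrite (derivationX derL) -mulr_natr (pcharf0 pL) mulr0 rpred0.
have iterA k : e l \in A l -> e (l + k * n) \in A (l + k * n)%N.
  move=> el; elim: k => [|k IHk]; first by rewrite mul0n addn0.
  by have := derA _ _ IHk; rewrite der_pt -addnA -mulSnr.
apply/negP => el; have {}el : e l \in A l.
  move: el; apply: sgen_min => y [|[z zF ->]].
    move: y; apply: sgen_min => y [?|[s]|[s [sl _] ->]] //; apply: sgen_mem; first exact: Or31.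
    by apply: Or32; exists s.
  move: z zF => {y}; apply: sgen_ind.
  - by rewrite expr1n rpred1.
  - by move=> x y ? ?; rewrite -!(pFrobenius_autE pL) rmorphB rpredB.
  - by move=> x y ? ?; rewrite expr_div_n rpred_div.
  - move=> z [/base_fieldP [c ->]|[s]|[s [sr _] ->]] //; apply: sgen_mem.
      by apply/Or31/base_fieldP; exists (c ^+ p); rewrite rmorphXn.
    by apply/Or33; exists s.
have := iterA r0.+1 el => h; apply: (free_not ((freeD l r0.+1).2 fl)).
apply: mem_sepalgebraic; move: h; apply: sgen_min => y [?|[s ? ->]|[s sr ->]].
- exact: stage_base.
- exact: stage_pt.
- by rewrite rpredX // stage_pt //; nia.
Qed.

(** In characteristic 0 algebraic means separably algebraic, and r would be a leader. In
    characteristic p, the free e_l with l < r are adjoined to K one after the other; each lies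
    outside the field of p-th powers, so separability survives up to e_r. *)
Lemma free_transcendental r : free_index r -> ~ algebraic_over (free_field r) (e r).
Proof.
move=> fr alg; have [[p pK]|nochar] := pselect (exists p, p \in [pchar K]); last first.
  apply: (free_not fr); apply: algebraic_sep0; last by apply: algebraic_overS alg; apply: free_field_stage.
  move=> p; rewrite (fmorph_pchar (de_inj L)) [RHS]inE; apply/negP => pK.
  by apply: nochar; exists p.
have pL : p \in [pchar L] by rewrite (fmorph_pchar (de_inj L)).
have sep l : (l <= r)%N -> pseparable p (free_field l) (free_field r.+1).
  elim: l => [_|l IHl lr].
    have sp : pseparable p K0 (free_field r.+1) by apply: separable_pseparable.
    apply: eq_pseparable sp => x; apply/idP/idP.
      by move=> ?; apply/sgen_mem/Or31.
    by move: x; apply: sgen_min => y [|[]|[s []]].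
  have [fl|nfl] := pselect (free_index l); last first.
    by apply: eq_pseparable (IHl (ltnW lr)) => x; rewrite free_fieldN.
  apply: (@eq_pseparable _ (adjoin (free_field l) (e l))); first by move=> x; rewrite free_fieldS.
  apply: pseparable_adjoin (IHl (ltnW lr)) _ _ => //.
    by apply/sgen_mem/Or33; exists l => //; split=> //; lia.
  by apply: free_pindependent => //; lia.
apply: (pseparable_transcendental pL (sep r (leqnn r))) alg.
  by apply/sgen_mem/Or33; exists r.
exact: free_pindependent.
Qed.

Lemma stable_stage : exists N, forall r, (N <= r)%N ->
  (free_index r -> ~ algebraic_over (E r) (e r)) /\
  (~ free_index r -> exists2 s, (s + n)%N = r & sep_stage s).
Proof.
have [M hM] := free_or_sep.
have memM r : (M + n <= r)%N -> ~ free_index r -> exists2 s, (s + n)%N = r & sep_stage s.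
  move=> Mr fr; exists (r - n)%N; first by lia.
  apply: hM; first by lia.
  by rewrite -(freeD _ 1); have -> : (r - n + 1 * n = r)%N by lia.
(* The free e_r are independent over K; exchange makes the large ones independent also over the
   field that contains e_0, ..., e_(M+n-1). *)
have [R0 hR] := seq_field_exchange (M + n)%N free_transcendental.
exists (maxn R0 (M + n)) => r Nr; split; last by apply: memM; lia.
move=> fr alg; apply: (hR r) => //; first by lia.
(* This larger field contains E_r: from M + n on, a generator that is not free lies in the field
   generated by the earlier ones. *)
apply: algebraic_overS alg; apply: sgen_min => y [?|[s sr ->]]; first by apply/sgen_mem/Or31.
elim/ltn_ind: s sr => s IHs sr.
have [sM|Ms] := ltnP s (M + n); first by apply/sgen_mem/Or32; exists s.
have [fs|nfs] := pselect (free_index s); first by apply/sgen_mem/Or33; exists s.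
have [t ts st] := memM s Ms nfs.
have := sep_stage_mem 0 st; rewrite mul1n ts.
apply: sgen_min => x [?|[u us ->]]; first by apply/sgen_mem/Or31.
by apply: IHs => //; apply: ltn_trans sr.
Qed.

End Separable.

(** * Finite presentation of the algebraic relations *)

Section FinitePresentation.
Variables (F : diffField) (eta : {rmorphism R -> F}).

(** Equivalently, sending eps f to eta f is well defined on K[e_s : s < r]. *)
Definition specialises r := forall f, f \in Pol r -> eps f = 0 -> eta f = 0.

(** A relation on a transcendental e_r holds coefficient by coefficient, so it imposes nothing
    new. *)
Lemma specialises_transcendental r : ~ algebraic_over (E r) (e r) ->
  specialises r -> specialises r.+1.
Proof.
move=> tr sp _ /Pol_succ [P hP ->]; rewrite -!horner_map => P0.
have {}P0 : map_poly eps P = 0.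
  apply/eqP/negPn/negP => Pn; apply: tr; exists (map_poly eps P) => //.
  by apply/polyOverP => i; rewrite coef_map stage_eps //; move/polyOverP: hP; apply.
suff -> : map_poly eta P = 0 by rewrite horner0.
apply/polyP => i; rewrite coef_map coef0 /= sp //; first by move/polyOverP: hP; apply.
by rewrite -[LHS](coef_map eps) P0 coef0.
Qed.

(** Pseudo-division by [Q] reduces a relation to one of lower degree in X_r, which by minimality
    holds coefficientwise and so is preserved; the power of the leading coefficient cancels in
    [F]. *)
Lemma specialises_algebraic r (Q : {poly R}) : Q \is a polyOver (Pol r) ->
  eps Q.[X r] = 0 -> eta Q.[X r] = 0 -> eta (lead_coef Q) != 0 ->
  (forall P : {poly R}, P \is a polyOver (Pol r) -> (size P < size Q)%N ->
     eps P.[X r] = 0 -> map_poly eps P = 0) ->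
  specialises r -> specialises r.+1.
Proof.
move=> hQ epsQ etaQ etal Qmin sp _ /Pol_succ [P hP ->] P0.
have Qn : Q != 0 by apply: contra_neq etal => ->; rewrite lead_coef0 rmorph0.
have [k [P1 [P2 [hP1 hP2 sP2 PE]]]] := pseudo_division Qn hQ hP.
have {}PE : lead_coef Q ^+ k * P.[X r] = P1.[X r] * Q.[X r] + P2.[X r].
  by rewrite -hornerZ PE !hornerE.
have P20 : map_poly eps P2 = 0.
  apply: Qmin => //; have := congr1 eps PE.
  by rewrite rmorphM P0 mulr0 rmorphD rmorphM epsQ mulr0 add0r.
have etaP2 : eta P2.[X r] = 0.
  rewrite -horner_map; suff -> : map_poly eta P2 = 0 by rewrite horner0.
  apply/polyP => i; rewrite coef_map coef0 /= sp //; first by move/polyOverP: hP2; apply.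
  by rewrite -[LHS](coef_map eps) P20 coef0.
have /eqP := congr1 eta PE; rewrite rmorphM rmorphD rmorphM etaQ etaP2 mulr0 addr0.
by rewrite mulf_eq0 rmorphXn expf_eq0 (negPf etal) andbF => /eqP.
Qed.
End FinitePresentation.

(** A triangular system: one minimal equation for each algebraic e_s, with [h] the product of their
    leading coefficients. *)
Lemma algebraic_presentation r : exists (fs : seq R) (h : R),
  [/\ forall f, f \in fs -> f \in Pol r /\ eps f = 0, h \in Pol r, eps h != 0 &
   forall (F : diffField) (eta : {rmorphism R -> F}),
     (forall f, f \in fs -> eta f = 0) -> eta h != 0 -> specialises eta r].
Proof.
elim: r => [|r [fs [h [hfs hh hn spec]]]].
  exists [::], 1; rewrite rpred1 rmorph1 oner_eq0; split=> // F eta _ _ f hf.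
  have [c ->] : exists c, f = C c.
    move: f hf; apply: rgen_ind => [|_ _ [a ->] [b ->]|_ _ [a ->] [b ->]|y [//|[]//]].
    - by exists 1; rewrite rmorph1.
    - by exists (a - b); rewrite rmorphB.
    - by exists (a * b); rewrite rmorphM.
  by rewrite epsC => /eqP; rewrite fmorph_eq0 => /eqP ->; rewrite !rmorph0.
have [|tr] := pselect (algebraic_over (E r) (e r)); last first.
  exists fs, h; split=> [f /hfs [? ?]| |//|F eta e0 en].
  - by split=> //; apply: PolS (leqnSn r) _ _.
  - exact: PolS (leqnSn r) _ _.
  - exact: specialises_transcendental tr (spec F eta e0 en).
move=> /algebraic_minpoly [q Eq [qn qe qmin]].
have [g [hg gn] [Q0 hQ0 Q0E]] := stage_poly Eq.
(* [Q0] may have terms beyond the degree of q that [eps] kills; truncation makes the leading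
   coefficient survive under [eps]. *)
pose Q := \poly_(i < size q) Q0`_i.
have hQ : Q \is a polyOver (Pol r).
  by apply: polyOver_poly => i _; move/polyOverP: hQ0; apply.
have QE : map_poly eps Q = eps g *: q.
  rewrite -Q0E; apply/polyP => i; rewrite !coef_map coef_poly; case: ltnP => //= qi.
  by rewrite rmorph0 -[RHS](coef_map eps) Q0E coefZ nth_default // mulr0.
have epsl : eps Q`_(size q).-1 != 0.
  by rewrite -(coef_map eps) QE coefZ mulf_neq0 // -lead_coefE lead_coef_eq0.
have sQ : size Q = size q.
  by rewrite size_poly_eq //; apply: contra_neq epsl; rewrite coef_poly prednK ?size_poly_gt0 // leqnn => ->; rewrite rmorph0.
have Ql : lead_coef Q = Q`_(size q).-1 by rewrite lead_coefE sQ.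
have Qe : eps Q.[X r] = 0 by rewrite -horner_map QE hornerZ qe mulr0.
have hl : lead_coef Q \in Pol r by rewrite Ql; move/polyOverP: hQ; apply.
exists (Q.[X r] :: fs), (h * lead_coef Q); split.
- move=> f; rewrite inE => /predU1P [->|/hfs [? ?]]; first by split=> //; apply: Pol_horner.
  by split=> //; apply: PolS (leqnSn r) _ _.
- by apply: (PolS (leqnSn r)); rewrite rpredM.
- by rewrite rmorphM mulf_neq0 // Ql.
move=> F eta e0; rewrite rmorphM mulf_eq0 negb_or => /andP [en el].
apply: (@specialises_algebraic F eta r Q) => //.
- by apply: e0; rewrite mem_head.
- move=> P hP; rewrite sQ => sP Pe; apply: qmin.
  + by apply/polyOverP => i; rewrite coef_map stage_eps //; move/polyOverP: hP; apply.
  + by apply: leq_ltn_trans sP; apply: size_poly.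
  + by rewrite horner_map.
- by apply: spec => // f hf; apply: e0; rewrite inE hf orbT.
Qed.

(** * Stable stages and the truncated derivation *)

Section StableStage.
Variable N : nat.
Hypothesis stableN : forall r, (N <= r)%N ->
  (free_index r -> ~ algebraic_over (E r) (e r)) /\
  (~ free_index r -> exists2 s, (s + n)%N = r & sep_stage s).

(** Past N, the relation for an index that is not free is a derivative of one fixed equation of its
    residue class, linear in its leader with the separant as coefficient. So it suffices to multiply
    [h] by n factors, and [fs] stays as it was. *)
Lemma finite_presentation : exists (fs : seq R) (h : R),
  [/\ forall f, f \in fs -> f \in Pol N /\ eps f = 0, h \in Pol N, eps h != 0 &
   forall (F : diffField) (eta : {rmorphism R -> F}),
     (forall f, eta (d f) = der (eta f)) ->
     (forall f, f \in fs -> eta f = 0) -> eta h != 0 -> forall r, specialises eta r].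
Proof.
have [fs [h [hfs hh hn spec]]] := algebraic_presentation N.
have /choice [sQ hsQ] : forall i : 'I_n, exists sQ : nat * {poly R}, ~ free_index (N + i) ->
    [/\ (sQ.1 + n = N + i)%N, sQ.2 \is a polyOver (Pol sQ.1), eps sQ.2.[X sQ.1] = 0 &
        eps sQ.2^`().[X sQ.1] != 0].
  move=> i; have [fi|nfi] := pselect (free_index (N + i)); first by exists (0%N, 0).
  have [s sE /sep_stageP [Q hQ [Q0 Q'n]]] := (stableN (leq_addr i N)).2 nfi.
  by exists (s, Q).
(* The leader N + i - n lies below N, so its equation is already covered by [spec]; a free class
   contributes the factor 1. *)
pose sg (i : 'I_n) := if pselect (free_index (N + i)) then 1 else (sQ i).2^`().[X (sQ i).1].
have hsg i : sg i \in Pol N /\ eps (sg i) != 0.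
  rewrite /sg; case: pselect => [fi|nfi] /=; first by rewrite rpred1 rmorph1 oner_eq0.
  have [sE hQ _ Q'n] := hsQ i nfi; split=> //.
  apply: (@PolS (sQ i).1.+1); first by have := ltn_ord i; lia.
  by apply: Pol_horner; rewrite polyOver_deriv.
exists fs, (h * \prod_i sg i); split=> //.
- by rewrite rpredM // rpred_prod // => i _; have [] := hsg i.
- rewrite rmorphM mulf_neq0 // rmorph_prod; apply/prodf_neq0 => i _.
  by have [] := hsg i.
move=> F eta eta_der e0; rewrite rmorphM mulf_eq0 negb_or rmorph_prod => /andP [en /prodf_neq0 esg].
have spN := spec F eta e0 en.
elim=> [|r IHr]; first by move=> f hf; apply: spN; apply: PolS hf.
have [rN|Nr] := ltnP r N; first by move=> f hf; apply: spN; apply: PolS hf.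
have [fr|nfr] := pselect (free_index r).
  exact: specialises_transcendental ((stableN Nr).1 fr) IHr.
have im : ((r - N) %% n < n)%N by rewrite ltn_mod.
pose i := Ordinal im; pose k := ((r - N) %/ n)%N.
have rE : (r = N + i + k * n)%N.
  by rewrite /= -addnA [(_ %% _ + _)%N]addnC -divn_eq subnKC.
have nfi : ~ free_index (N + i) by move: nfr; rewrite rE freeD.
have [sE hQ Qe Q'n] := hsQ i nfi; have := esg i isT; rewrite /sg; case: pselect => //= nfi'.
move: (sQ i) sE hQ Qe Q'n => [s Q] /= sE hQ Qe Q'n etaQ'.
have [f hf fE] := separant_iter k hQ.
have sr : (s + k.+1 * n = r)%N by rewrite rE -sE mulSn; lia.
rewrite sr in hf fE.
have Q's : Q^`().[X s] \in Pol r.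
  by apply: (@PolS s.+1); [move: sr n_gt0; nia | apply: Pol_horner; rewrite polyOver_deriv].
(* The (k+1)-st derivative of the equation, as a polynomial of degree 1 in X_r. *)
pose P := Q^`().[X s] *: 'X + f%:P.
have PX : P.[X r] = iter k.+1 d Q.[X s] by rewrite fE !hornerE.
have Pn : Q^`().[X s] != 0 by apply: contra_neq Q'n => ->; rewrite rmorph0.
have sP : size P = 2.
  have Pj j : P`_j = Q^`().[X s] * (j == 1%N)%:R + (if j == 0%N then f else 0).
    by rewrite /P coefD coefZ coefX coefC.
  apply/eqP; rewrite eqn_leq ltnNge; apply/andP; split.
    by apply/leq_sizeP => -[|[|j]] // _; rewrite Pj mulr0 addr0.
  by apply: contra Pn => /leq_sizeP /(_ 1%N isT); rewrite Pj mulr1 addr0 => ->.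
have hP : P \is a polyOver (Pol r).
  by apply: rpredD; [apply: polyOverZ => //; apply: polyOverX | rewrite polyOverC].
have iter0 (G : diffField) (u : {rmorphism R -> G}) m : (forall f, u (d f) = der (u f)) ->
    u Q.[X s] = 0 -> u (iter m d Q.[X s]) = 0.
  by move=> ud u0; elim: m => //= m IHm; rewrite ud IHm (derivation0 (@der_derivation G)).
apply: (@specialises_algebraic F eta r P) => //.
- by rewrite PX iter0.
- rewrite PX iter0 //; apply: spN => //.
  by apply: (@PolS s.+1); [move: (ltn_ord i) sE => /=; lia | apply: Pol_horner].
- rewrite lead_coefE sP /= /P coefD coefZ coefX coefC mulr1 addr0.
  exact: etaQ'.
- move=> P2 hP2; rewrite sP ltnS => /size1_polyC ->.
  by rewrite hornerC map_polyC /= => ->.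
Qed.

(* The derivation maps E N into E N (+) top_span; the first component of its
   values is the derivation put on E N in stage_diffExt. *)
Definition top_span x := exists2 c : 'I_n -> L, forall i, c i \in E N &
  x = \sum_i c i * (if pselect (free_index (N + i)) then e (N + i) else 0).

(** The last free e_(N+m) in a nonzero term would lie in E_(N+m), over which it is transcendental.
    Hence the sum of E_N and [top_span] is direct. *)
Lemma top_span_stage x : top_span x -> x \in E N -> x = 0.
Proof.
move=> [c Ec ->].
(* Coefficients indexed by all natural numbers let the induction run on the number of terms. *)
pose c' i := oapp c 0 (insub i : option 'I_n).
have Ec' i : c' i \in E N by rewrite /c'; case: (insub i : option 'I_n) => [j|] /=; rewrite ?rpred0.
pose t i := if pselect (free_index (N + i)) then e (N + i) else 0.
rewrite (eq_bigr (fun i : 'I_n => c' i * t i)); last by move=> i _; rewrite /c' valK.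
elim: n => [|m IHm]; first by rewrite big_ord0.
rewrite big_ord_recr /=.
have [ct0|] := eqVneq (c' m * t m) 0; first by rewrite ct0 addr0.
rewrite mulf_eq0 negb_or => /andP [cm tm] h.
have [fm tE] : free_index (N + m) /\ t m = e (N + m).
  by move: tm; rewrite /t; case: pselect => //= _; rewrite eqxx.
case: ((stableN (leq_addr m N)).1 fm); apply: mem_algebraic.
move: h; set s := \sum_(i < m) _ => h.
have -> : e (N + m) = (s + c' m * t m - s) / c' m.
  by rewrite addrAC subrr add0r mulrC mulKf.
have le : (N <= N + m)%N by rewrite leq_addr.
rewrite rpred_div ?rpredB //; [exact: (stageS le) | | exact: (stageS le)].
rewrite rpred_sum // => i _; rewrite rpredM //; first exact: (stageS le).
by rewrite /t; case: pselect => fi /=; rewrite ?rpred0 // stage_pt // ltn_add2l.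
Qed.

Lemma top_spanD x y : top_span x -> top_span y -> top_span (x + y).
Proof.
move=> [a Ea ->] [b Eb ->]; exists (fun i => a i + b i); first by move=> i; rewrite rpredD.
by rewrite -big_split; apply: eq_bigr => i _; rewrite mulrDl.
Qed.

Lemma top_spanM a x : a \in E N -> top_span x -> top_span (a * x).
Proof.
move=> Ea [b Eb ->]; exists (fun i => a * b i); first by move=> i; rewrite rpredM.
by rewrite mulr_sumr; apply: eq_bigr => i _; rewrite mulrA.
Qed.

Lemma top_span0 : top_span 0.
Proof. by exists (fun=> 0); rewrite ?rpred0 // big1 // => i _; rewrite mul0r. Qed.

Lemma top_spanN x : top_span x -> top_span (- x).
Proof. by rewrite -mulN1r => h; apply: top_spanM; rewrite ?rpredN ?rpred1. Qed.

Definition top_stage x := exists2 y, y \in E N & top_span (x - y).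

Lemma top_stageD x y : top_stage x -> top_stage y -> top_stage (x + y).
Proof.
move=> [a Ea ha] [b Eb hb]; exists (a + b); first by rewrite rpredD.
by rewrite opprD addrACA; apply: top_spanD.
Qed.

Lemma top_stageM a x : a \in E N -> top_stage x -> top_stage (a * x).
Proof.
move=> Ea [b Eb hb]; exists (a * b); first by rewrite rpredM.
by rewrite -mulrBr; apply: top_spanM.
Qed.

Lemma stage_top_stage x : x \in E N -> top_stage x.
Proof. by move=> Ex; exists x => //; rewrite subrr; apply: top_span0. Qed.

Lemma top_stageN x : top_stage x -> top_stage (- x).
Proof. by rewrite -mulN1r => h; apply: top_stageM; rewrite ?rpredN ?rpred1. Qed.

(** By induction on the generators: a derivative e_(s+n) past N is either free, hence in [top_span],
    or found by differentiating a separable equation of e_s over E_s and solving for it. *)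
Lemma stage_der x : x \in E N -> top_stage (der x).
Proof.
pose S x := x \in E N /\ top_stage (der x).
suff : x \in E N -> S x by move=> h /h [].
have S1 : S 1.
  by split; rewrite ?rpred1 // (derivation1 derL); apply: stage_top_stage; rewrite rpred0.
have SB a b : S a -> S b -> S (a - b).
  move=> [Ea ha] [Eb hb]; split; rewrite ?rpredB // (derivationB derL).
  exact: top_stageD (top_stageN hb).
have SV a b : S a -> S b -> S (a / b).
  move=> [Ea ha] [Eb hb]; split; rewrite ?rpred_div // (derivation_div derL).
  rewrite [_ / _ ^+ 2]mulrC; apply: top_stageM; first by rewrite rpredV rpredX.
  apply: top_stageD; first by rewrite mulrC; apply: top_stageM.
  by apply: top_stageN; apply: top_stageM.
have SK a : a \in K0 -> S a.
  move=> /base_fieldP [c ->]; rewrite /S -de_injE; split; last apply: stage_top_stage.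
    by apply/stage_base/base_fieldP; exists c.
  by apply/stage_base/base_fieldP; exists (der c).
move: x; apply: sgen_ind => // y [/SK //|[s sN ->]] {y}.
elim/ltn_ind: s sN => s IHs sN; split; first exact: stage_pt.
rewrite der_pt; have [lt_N|le_N] := ltnP (s + n) N.
  by apply: stage_top_stage; apply: stage_pt.
have [fs|nfs] := pselect (free_index (s + n)).
  exists 0; rewrite ?rpred0 // subr0.
  have im : (s + n - N < n)%N by lia.
  exists (fun i => (i == Ordinal im)%:R); first by move=> i; rewrite rpred_nat.
  rewrite (bigD1 (Ordinal im)) //= eqxx mul1r big1; last first.
    by move=> i /negPf ->; rewrite mul0r.
  by rewrite addr0 subnKC //; case: pselect.
have [s' s'E] := (stableN le_N).2 nfs; have {s' s'E}-> : s' = s by lia.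
move=> [p Ep [pe p'e]].
(* The coefficients of p involve only the e_t with t < s, which the induction hypothesis covers. *)
have Ss a : a \in E s -> S a.
  move: a; apply: sgen_ind => // y [/SK //|[t ts ->]].
  by apply: IHs => //; apply: ltn_trans sN.
have := derivation_horner derL p (e s); rewrite pe (derivation0 derL) der_pt => /esym/eqP.
rewrite addrC addr_eq0 => /eqP eE.
have -> : e (s + n) = (p^`().[e s])^-1 * (- (map_poly der p).[e s]).
  by rewrite -eE mulKf.
apply: top_stageM.
  rewrite rpredV rpred_horner ?stage_pt // polyOver_deriv //; apply: polyOverS Ep.
  by apply: stageS; apply: ltnW.
apply: top_stageN; rewrite horner_coef.
elim/big_rec: _ => [|i y _ hy]; first by apply: stage_top_stage; rewrite rpred0.
apply: top_stageD hy; rewrite mulrC; apply: top_stageM; first by rewrite rpredX // stage_pt.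
rewrite coef_map_id0 ?(derivation0 derL) //.
by have [] : S p`_i by apply: Ss; move/polyOverP: Ep; apply.
Qed.

(** Following the derivation of L by the projection to E_N preserves the Leibniz rule because
    [top_span] is stable under multiplication by E_N. On e_s with s + n < N nothing is truncated. *)
Lemma stage_diffExt : exists (L' : diffExt K) (v : {rmorphism L' -> L}),
  [/\ forall c, v (de_inj L' c) = de_inj L c,
      forall x, v x \in E N,
      forall x, x \in E N -> exists y, v y = x &
      forall s y, (s + n < N)%N -> v y = e s -> v (der y) = e (s + n)].
Proof.
pose T := subfield_type (E N).
have /choice [D hD] : forall x : T, exists y : T, top_span (der (val x) - val y).
  by move=> x; have [y Ey hy] := stage_der (valP x); exists (Sub y Ey).
have D_uniq (x : T) y : y \in E N -> top_span (der (val x) - y) -> val (D x) = y.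
  move=> Ey hy; apply/eqP; rewrite -subr_eq0; apply/eqP; apply: top_span_stage.
    have := top_spanD hy (top_spanN (hD x)); congr (top_span _).
    by rewrite opprB addrC addrA subrK.
  by rewrite rpredB //; apply: valP.
have DD : derivation D.
  split=> x y; apply: val_inj; apply: D_uniq; rewrite ?rpredD ?rpredM ?(valP (D _)) ?(valP x) ?(valP y) //=.
    by rewrite (derivationD derL) opprD addrACA; apply: top_spanD (hD x) (hD y).
  rewrite (derivationM derL) opprD addrACA; apply: top_spanD.
    by rewrite -mulrBl mulrC; apply: top_spanM (valP y) (hD x).
  by rewrite -mulrBr; apply: top_spanM (valP x) (hD y).
have KE c : de_inj L c \in E N by apply/stage_base/base_fieldP; exists c.
pose L'0 := @DiffField T D DD.
have injE c : restrict_base KE (der c) = D (restrict_base KE c) :> T.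
  apply: val_inj; apply/esym; apply: D_uniq => //=.
  by rewrite de_injE subrr; apply: top_span0.
pose L' := @DiffExt K L'0 (restrict_base KE) injE.
exists L', (val : T -> L); split=> //=.
- by move=> x; apply: valP.
- by move=> x Ex; exists (Sub x Ex).
- move=> s y sN ys; apply: D_uniq; first exact: stage_pt.
  by rewrite [val y]ys der_pt subrr; apply: top_span0.
Qed.
End StableStage.
End Prolongation.

(** * Differential polynomials *)

Section DPolyInduction.
Variables (K : diffField) (n : nat).

Lemma dpoly_ind (Q : dpoly K n -> Prop) :
  (forall c, Q (dpolyC n c)) -> (forall i j, Q (dpolyX K i j)) ->
  (forall f g, Q f -> Q g -> Q (f + g)) -> (forall f g, Q f -> Q g -> Q (f * g)) ->
  forall f, Q f.
Proof.
move=> QC QX QD QM f.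
have Qm (m : {cmonom ('I_n * nat)%type}) : Q << m >>.
  have [k] := ubnP (mdeg m); elim: k m => // k IHk m.
  have [->|m1] := eqVneq m mone; first by have := QC 1; rewrite /dpolyC. 
  have [v mv] : exists v, (0 < m v)%N.
    have /fset0Pn [v] : finsupp m != fset0.
      apply: contraNneq m1 => m0; apply/cmP => v.
      by rewrite cm1; apply/eqP; rewrite cmE_eq0 m0.
    by rewrite -cmE_neq0 -lt0n; exists v.
  have -> : m = mmul (ucm v) (divcm m (ucm v)).
    apply/eqP/cmP => w; rewrite cmM divcmE ucmE.
    by case: eqVneq => [<-|_] /=; rewrite ?add0n ?subn0 // subnKC.
  move: (divcm m (ucm v)) => m'; rewrite mdegM mdegU add1n ltnS => m'k.
  rewrite -[X in << X *g _ >>]mulr1 -malgMUU; apply: QM; last exact: IHk.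
  by case: v {mv m1 m'k} => i j; apply: QX.
rewrite (monalgE f); elim/big_rec: _ => [|m g _ Qg].
  by have := QC 0; rewrite (rmorph0 (@dpolyC K n)).
apply: QD Qg; rewrite -[X in << X *g _ >>]mulr1 -[m]mul1m -malgMUU.
by apply: QM (Qm m); apply: QC.
Qed.

Lemma dpoly_morphism_eq (S : nzRingType) (u v : {rmorphism dpoly K n -> S}) :
  (forall c, u (dpolyC n c) = v (dpolyC n c)) ->
  (forall i j, u (dpolyX K i j) = v (dpolyX K i j)) -> u =1 v.
Proof.
by move=> uC uX; elim/dpoly_ind => // f g uf ug; rewrite ?rmorphD ?rmorphM uf ug.
Qed.

Variables (S : comNzRingType) (phi : {rmorphism K -> S}) (x : 'I_n * nat -> S).

(** Unlike in [mon_eval], the indeterminates (i, j) take arbitrary values, which need not be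
    successive derivatives. *)
Definition mon_value (m : {cmonom ('I_n * nat)%type}) : S :=
  \prod_(v <- finsupp m) x v ^+ m v.

Fact mon_value_mmorphism : mmorphism mon_value.
Proof.
have Ew (d : {fset ('I_n * nat)%type}) (m : {cmonom ('I_n * nat)%type}) : (finsupp m `<=` d)%fset ->
    mon_value m = \prod_(v <- d) x v ^+ m v.
  move=> le; rewrite /mon_value (big_fset_incl _ le) // => v _.
  by rewrite -cmE_eq0 => /eqP->.
split=> [m1 m2|]; last by rewrite /mon_value mdom1 big_seq_fset0.
rewrite (Ew (finsupp m1 `|` finsupp m2)%fset); last by rewrite mdomD.
rewrite (Ew (finsupp m1 `|` finsupp m2)%fset m1) ?fsubsetUl //.
rewrite (Ew (finsupp m1 `|` finsupp m2)%fset m2) ?fsubsetUr //.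
by rewrite -big_split; apply: eq_bigr => v _; rewrite cmM exprD.
Qed.

HB.instance Definition _ :=
  isMultiplicative.Build {cmonom ('I_n * nat)%type} S mon_value mon_value_mmorphism.

Definition dpoly_value (f : dpoly K n) : S := mmap phi mon_value f.

HB.instance Definition _ := GRing.RMorphism.copy dpoly_value (mmap phi mon_value).

Lemma dpoly_valueC c : dpoly_value (dpolyC n c) = phi c.
Proof. exact: mmapC. Qed.

Lemma dpoly_valueX i j : dpoly_value (dpolyX K i j) = x (i, j).
Proof.
by rewrite /dpoly_value mmapU /= rmorph1 mul1r /mon_value mdomU big_seq_fset1 cmUU.
Qed.
End DPolyInduction.

Section Evaluation.
Variables (K : diffField) (n : nat) (L : diffExt K) (a : 'I_n -> L).
Implicit Types f g : dpoly K n.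

Lemma dpoly_evalD f g : dpoly_eval a (f + g) = dpoly_eval a f + dpoly_eval a g.
Proof. exact: rmorphD. Qed.
Lemma dpoly_evalB f g : dpoly_eval a (f - g) = dpoly_eval a f - dpoly_eval a g.
Proof. exact: rmorphB. Qed.
Lemma dpoly_evalM f g : dpoly_eval a (f * g) = dpoly_eval a f * dpoly_eval a g.
Proof. exact: rmorphM. Qed.

(* Rewriting makes the unifier compare the monomials of dpolyX and dpolyC, which
   diverges. *)
Lemma dpoly_evalXsubC i c : dpoly_eval a (dpolyX K i 0 - dpolyC n c) = a i - de_inj L c.
Proof.
exact (etrans (dpoly_evalB _ _)
  (f_equal2 (fun x y => x - y) (dpoly_evalX a i 0) (dpoly_evalC a c))).
Qed.
End Evaluation.

Section Terms.
Variables (K : diffField) (n : nat).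

Lemma dpoly_dterm (f : dpoly K n) : exists t : dterm K n,
  forall (L : diffExt K) (a : 'I_n -> L), dterm_eval a t = dpoly_eval a f.
Proof.
elim/dpoly_ind: f => [c|i j|f g [t ht] [u hu]|f g [t ht] [u hu]].
- by exists (TPar n c) => L a; rewrite dpoly_evalC.
- exists (iter j (@TDer K n) (TVar K i)) => L a; rewrite dpoly_evalX.
  by elim: j => //= j ->.
- by exists (TAdd t u) => L a; rewrite /= ht hu rmorphD.
- by exists (TMul t u) => L a; rewrite /= ht hu rmorphM.
Qed.

Lemma existentially_closed_dpoly (L : diffExt K) (b : 'I_n -> L) (fs : seq (dpoly K n)) h :
  existentially_closed L -> (forall f, f \in fs -> dpoly_eval b f = 0) ->
  dpoly_eval b h != 0 ->
  exists2 c : 'I_n -> diffExt_refl K, forall f, f \in fs -> dpoly_eval c f = 0 &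
    dpoly_eval c h != 0.
Proof.
move=> ec; have [phi hphi] : exists phi : dqf K n, forall (L : diffExt K) (a : 'I_n -> L),
    dqf_holds a phi <-> (forall f, f \in fs -> dpoly_eval a f = 0) /\ dpoly_eval a h != 0.
  elim: fs => [|f fs [phi hphi]].
    have [t ht] := dpoly_dterm h; exists (FNot (FEq t (TZero K n))) => M a /=; rewrite ht.
    by split=> [hn|[_ /eqP]] //; split=> //; apply/eqP.
  have [t ht] := dpoly_dterm f; exists (FAnd (FEq t (TZero K n)) phi) => M a /=; rewrite ht hphi.
  split=> [[f0 [fs0 hn]]|[fs0 hn]].
    by split=> // g; rewrite inE => /predU1P [->|/fs0].
  split; first by apply: fs0; rewrite mem_head.
  by split=> // g gfs; apply: fs0; rewrite inE gfs orbT.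
move=> fs0 hn; have [|c /hphi [c0 cn]] := ec n phi; last by exists c.
by exists b; apply/hphi.
Qed.
End Terms.

(** * Fraction fields and derivations *)

Local Open Scope quotient_scope.

Section FractionDerivation.
Variables (R : comNzRingType) (F : fieldType) (d : R -> R) (pi : {rmorphism R -> F}).
Hypotheses (dd : derivation d) (ker_d : forall f, pi f = 0 -> pi (d f) = 0).
Hypothesis pi_frac : forall x, exists f g, pi g != 0 /\ x = pi f / pi g.

(** Two representations f0 / g0 and f / g of x give the kernel element f0 g - f g0, whose derivative
    is again in the kernel; this makes the quotient rule well defined. *)
Lemma fraction_derivation : exists2 D : F -> F, derivation D &
  forall f, D (pi f) = pi (d f).
Proof.
have pi_mul x : exists f g, pi g != 0 /\ pi f = x * pi g.
  by have [f [g [gn ->]]] := pi_frac x; exists f, g; rewrite divfK.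
(* The quotient rule multiplied out, required for all representations of x so that sums and products
   may use any common denominator. *)
have /choice [D hD] : forall x, exists y, forall f g, pi g != 0 -> pi f = x * pi g ->
    y * pi g = pi (d f) - x * pi (d g).
  move=> x; have [f0 [g0 [g0n f0E]]] := pi_mul x.
  exists ((pi (d f0) - x * pi (d g0)) / pi g0) => f g gn fE.
  have /ker_d : pi (f0 * g - f * g0) = 0.
    by rewrite rmorphB !rmorphM f0E fE; ring.
  rewrite (derivationB dd) !(derivationM dd) !(rmorphB, rmorphD, rmorphM) f0E fE => /eqP.
  rewrite subr_eq0 => /eqP h; apply: (mulIf g0n).
  transitivity ((pi (d f0) - x * pi (d g0)) * pi g); first by field.
  apply/eqP; rewrite -subr_eq0 -[X in _ == X](subrr (pi (d f) * pi g0 + x * pi g * pi (d g0))).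
  by rewrite -{1}h; apply/eqP; ring.
exists D.
  split=> x y; have [f1 [g1 [n1 E1]]] := pi_mul x; have [f2 [g2 [n2 E2]]] := pi_mul y.
    have gn : pi (g1 * g2) != 0 by rewrite rmorphM mulf_neq0.
    apply: (mulIf gn).
    rewrite (hD (x + y) (f1 * g2 + f2 * g1) (g1 * g2)) //; last first.
      by rewrite rmorphD !rmorphM E1 E2; ring.
    have -> : (D x + D y) * pi (g1 * g2) =
        (D x * pi g1) * pi g2 + pi g1 * (D y * pi g2) by rewrite rmorphM; ring.
    rewrite (hD x f1 g1) // (hD y f2 g2) //.
    rewrite (derivationD dd) !(derivationM dd) !(rmorphD, rmorphM) E1 E2; ring.
  have gn : pi (g1 * g2) != 0 by rewrite rmorphM mulf_neq0.
  apply: (mulIf gn).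
  rewrite (hD (x * y) (f1 * f2) (g1 * g2)) //; last by rewrite !rmorphM E1 E2; ring.
  have -> : (D x * y + x * D y) * pi (g1 * g2) =
      (D x * pi g1) * y * pi g2 + x * pi g1 * (D y * pi g2) by rewrite rmorphM; ring.
  rewrite (hD x f1 g1) // (hD y f2 g2) // !(derivationM dd) !(rmorphD, rmorphM) E1 E2; ring.
move=> f; have := hD (pi f) f 1; rewrite rmorph1 oner_eq0 !mulr1 => -> //.
by rewrite (derivation1 dd) rmorph0 mulr0 subr0.
Qed.

Lemma common_denominator m (x : 'I_m -> F) :
  exists2 g, pi g != 0 & exists f : 'I_m -> R, forall i, pi g * x i = pi (f i).
Proof.
elim: m x => [|m IHm] x.
  by exists 1; rewrite ?rmorph1 ?oner_eq0 //; exists (fun=> 0); case.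
have [g gn [f fE]] := IHm (fun i => x (lift ord0 i)).
have [f1 [g1 [n1 xE]]] := pi_frac (x ord0).
exists (g * g1); first by rewrite rmorphM mulf_neq0.
exists (fun i => if unlift ord0 i is Some j then g1 * f j else g * f1) => i.
case: unliftP => [j ->|->]; rewrite !rmorphM; first by rewrite mulrAC fE mulrC.
by rewrite xE -mulrA; congr (_ * _); rewrite mulrC divfK.
Qed.
End FractionDerivation.

Section PrimeQuotientTheory.
Variables (R : comNzRingType) (P : prime_idealr R).

Lemma pquot_frac_pi_eq0 f : pquot_frac_pi P f = 0 <-> f \in P.
Proof.
have -> : (pquot_frac_pi P f = 0) <-> (\pi_({ideal_quot P}) f = 0 :> pquot P).
  split=> [/eqP|h]; last by rewrite /pquot_frac_pi h rmorph0.
  by rewrite /pquot_frac_pi tofrac_eq0 => /eqP.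
have eqP' := Quotient.idealrBE P f 0; rewrite subr0 in eqP'; rewrite eqP'.
by split=> [h|/eqP]; [apply/eqP; rewrite h|] ; rewrite rmorph0.
Qed.

Lemma pquot_frac_pi_frac (x : pquot_frac P) :
  exists f g, pquot_frac_pi P g != 0 /\ x = pquot_frac_pi P f / pquot_frac_pi P g.
Proof.
have frac (D : idomainType) (y : {fraction D}) : exists a b : D, b != 0 /\ y = tofrac a / tofrac b.
  elim/quotW: y => y; exists \n_y, \d_y; have dn := denom_ratioP y; split=> //.
  have dn' : tofrac \d_y != 0 by rewrite tofrac_eq0.
  apply: (mulIf dn'); rewrite divfK //.
  unlock FracField.tofrac; rewrite -[LHS]FracField.pi_mul /FracField.mulf; apply/eqmodP.
  by rewrite /= FracField.equivfE !numden_Ratio ?mulr1 ?oner_eq0 // mulrC.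
have [a [b [bn ->]]] := frac _ x.
exists (repr (a : {ideal_quot P})), (repr (b : {ideal_quot P})).
by rewrite /pquot_frac_pi !reprK tofrac_eq0.
Qed.
End PrimeQuotientTheory.

(** * Prime differential ideals and generic points *)

Section PrimeIdeals.
Variable R : comNzRingType.

Definition prop_pred (Q : R -> Prop) : {pred R} := fun f => `[< Q f >].

Definition prime_ideal_prop (Q : R -> Prop) :=
  [/\ Q 0, ~ Q 1, forall a f g, Q f -> Q g -> Q (a * f + g) &
      forall f g, Q (f * g) -> Q f \/ Q g].

Lemma prime_idealr_of (Q : R -> Prop) : prime_ideal_prop Q ->
  exists P : prime_idealr R, forall f, f \in P <-> Q f.
Proof.
move=> [Q0 Q1 Qi Qp].
have cl : idealr_closed (prop_pred Q).
  split=> [| |a f g /asboolP Qf /asboolP Qg]; try apply/asboolP => //.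
  exact: Qi.
have pr : prime_idealr_closed (prop_pred Q).
  by move=> f g /asboolP /Qp [] ?; apply/orP; [left | right]; apply/asboolP.
pose P : prime_idealr R := HB.pack (prop_pred Q) (isIdealr.Build R (prop_pred Q) cl)
  (isPrimeIdealrClosed.Build R (prop_pred Q) pr).
by exists P => f; split=> /asboolP.
Qed.

Lemma prime_idealr_prop (P : prime_idealr R) : prime_ideal_prop (fun f => f \in P).
Proof.
split=> [||a f g Pf Pg|f g]; first exact: rpred0.
- by rewrite idealr1.
- by rewrite rpredD // idealMr.
- by rewrite prime_idealrM => /orP.
Qed.

Lemma kernel_prime (F : fieldType) (pi : {rmorphism R -> F}) :
  prime_ideal_prop (fun f => pi f = 0).
Proof.
split=> [||a f g f0 g0|f g].
- exact: rmorph0.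
- by rewrite rmorph1; apply/eqP; rewrite oner_eq0.
- by rewrite rmorphD rmorphM f0 g0 mulr0 addr0.
- by rewrite rmorphM => /eqP; rewrite mulf_eq0 => /orP [] /eqP; [left | right].
Qed.
End PrimeIdeals.

(** * Separability of prime ideals *)

Section SeparableIdeals.
Variables (K : diffField) (n : nat).
Local Notation R := (dpoly K n).

(* Separability of an ideal, without reference to its fraction field. *)
Definition separable_prop (Q : R -> Prop) := forall p, p \in [pchar K] ->
  forall m (c : 'I_m -> K), lin_indep (powers p (fun _ => True)) c ->
  forall f : 'I_m -> R, Q (\sum_i dpolyC n (c i) * f i ^+ p) -> forall i, Q (f i).

Variables (L : fieldType) (iota : {rmorphism K -> L}) (pi : {rmorphism R -> L}).
Hypothesis piC : forall c, pi (dpolyC n c) = iota c.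

Lemma separable_in_prop (F : L -> Prop) : (forall f, F (pi f)) ->
  separable_in iota F -> separable_prop (fun f => pi f = 0).
Proof.
move=> piF sep p pK m c ind f f0 i.
have p0 : (0 < p)%N by rewrite prime_gt0 // (pcharf_prime pK).
have /eqP : pi (f i) ^+ p = 0.
  apply: (sep p pK m (fun i => iota (c i)) _ _ (fun i => pi (f i) ^+ p)).
  - by move=> j; exists (c j).
  - move=> a ap a0.
    have /choice [b hb] : forall j, exists x, a j = iota (x ^+ p).
      by move=> j; have [_ [x ->] ->] := ap j; exists x; rewrite rmorphXn.
    move=> j; rewrite hb (ind (fun j => b j ^+ p)) ?rmorph0 // => [k|].
      by exists (b k).
    apply: (fmorph_inj iota); rewrite rmorph0 -[RHS]a0 rmorph_sum.
    by apply: eq_bigr => k _; rewrite rmorphM hb.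
  - by move=> j; exists (pi (f j)).
  - rewrite -[RHS]f0 rmorph_sum; apply: eq_bigr => j _.
    by rewrite rmorphM /= piC rmorphXn mulrC.
by rewrite expf_eq0 p0 => /eqP.
Qed.

(** A common denominator reduces p-th powers of fractions to p-th powers of differential
    polynomials, which the condition on the ideal controls. *)
Lemma separable_prop_ext : (forall x, exists f g, pi g != 0 /\ x = pi f / pi g) ->
  separable_prop (fun f => pi f = 0) -> separable_ext iota.
Proof.
move=> pi_frac sep K' p pK m b bK ind a aF a0.
have p0 : (0 < p)%N by rewrite prime_gt0 // (pcharf_prime pK).
have /choice [c bE] := bK.
have /choice [x xE] : forall i, exists x, a i = x ^+ p.
  by move=> i; have [x _ ->] := aF i; exists x.
have [g gn [f fE]] := common_denominator pi_frac x.
suff f0 i : pi (f i) = 0.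
  move=> i; rewrite xE; have /eqP : pi g * x i = 0 by rewrite fE f0.
  by rewrite mulf_eq0 (negPf gn) => /eqP ->; rewrite expr0n; case: (p) p0.
move: i; apply: (sep p pK m c); last first.
  rewrite rmorph_sum -[RHS](mulr0 (pi g ^+ p)) -[in RHS]a0 mulr_sumr.
  apply: eq_bigr => i _; rewrite rmorphM /= piC rmorphXn -fE exprMn xE bE.
  by rewrite [RHS]mulrA mulrC.
move=> u up u0 i.
apply: (fmorph_inj iota); rewrite rmorph0; move: i; apply: (ind (fun i => iota (u i))).
  by move=> i; have [y _ ->] := up i; exists (iota y); [exists y | rewrite rmorphXn].
by rewrite -[RHS](rmorph0 iota) -u0 rmorph_sum; apply: eq_bigr => i _; rewrite rmorphM bE.
Qed.
End SeparableIdeals.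

(** * Generic zeros and vanishing ideals *)

Section GenericPoint.
Variables (K : diffField) (n : nat).
Local Notation R := (dpoly K n).

Lemma eq_separable_prop (Q Q' : R -> Prop) : (forall f, Q f <-> Q' f) ->
  separable_prop Q -> separable_prop Q'.
Proof. by move=> QQ' sep p pK m c ind f /QQ' h i; apply/QQ'; apply: (sep p pK m c). Qed.

Lemma separable_idealP (P : prime_idealr R) :
  separable_ideal P <-> separable_prop (fun f => f \in P).
Proof.
have eqP f : pquot_frac_pi P f = 0 <-> f \in P := pquot_frac_pi_eq0 P f.
split=> [sep|sep].
  apply: eq_separable_prop eqP _.
  exact: (@separable_in_prop K n _ _ (pquot_frac_pi P) _ (fun=> True) _ sep).
apply: (@separable_prop_ext K n _ _ (pquot_frac_pi P)) => //.
  exact: pquot_frac_pi_frac.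
by apply: eq_separable_prop sep => f; rewrite eqP.
Qed.

(** L is the fraction field of K{x}/P, with the derivation that P, being differential, lets through,
    and a consists of the classes of the x_i. *)
Lemma generic_point (P : prime_idealr R) : diff_ideal P ->
  exists (L : diffExt K) (a : 'I_n -> L), (forall f, dpoly_eval a f = 0 <-> f \in P) /\
    (separable_ideal P -> separable_ext (de_inj L)).
Proof.
move=> dP.
have ker_d f : pquot_frac_pi P f = 0 -> pquot_frac_pi P (dpoly_der f) = 0.
  by move/pquot_frac_pi_eq0 => Pf; apply/pquot_frac_pi_eq0/dP.
have [D Dd DE] := fraction_derivation (@dpoly_der_derivation K n) ker_d (@pquot_frac_pi_frac _ P).
have iterD i j : iter j D (pquot_frac_pi P (dpolyX K i 0)) = pquot_frac_pi P (dpolyX K i j).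
  elim: j => [|j IHj]; first by [].
  refine (etrans (congr1 D IHj) (etrans (DE _) _)).
  exact (congr1 (pquot_frac_pi P) (dpoly_derX K i j)).
pose L0 := @DiffField (pquot_frac P) D Dd.
pose iota : {rmorphism K -> L0} := (@pquot_frac_pi _ P \o @dpolyC K n : {rmorphism K -> pquot_frac P}).
have iotaE (c : K) : iota (der c) = der (iota c) by rewrite /= DE dpoly_derC.
pose L := @DiffExt K L0 iota iotaE.
pose a i : L := pquot_frac_pi P (dpolyX K i 0).
exists L, a; split=> // f; rewrite -pquot_frac_pi_eq0.
suff -> : dpoly_eval a f = pquot_frac_pi P f by [].
refine (@dpoly_morphism_eq K n L (dpoly_eval a) (pquot_frac_pi P) _ _ f) => [c|i j].
- exact: (@dpoly_evalC K n L a c).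
- exact (etrans (@dpoly_evalX K n L a i j) (iterD i j)).
Qed.

Lemma vanishing_ideal (L : diffExt K) (a : 'I_n -> L) :
  separable_in (de_inj L) (df_adjoin a) ->
  exists P : prime_idealr R, [/\ forall f, f \in P <-> dpoly_eval a f = 0,
    diff_ideal P & separable_ideal P].
Proof.
move=> sep; have [P PE0] := prime_idealr_of (kernel_prime (dpoly_eval a)).
have PE f : f \in P <-> dpoly_eval a f = 0 := PE0 f.
exists P; split=> // [f /PE f0|].
  by apply/PE; rewrite dpoly_eval_der f0 der0.
apply/separable_idealP; apply: eq_separable_prop (fun f => iff_sym (PE f)) _.
have Fa f : df_adjoin a (dpoly_eval a f).
  move=> F [F1 FB FM FV FD] FK Fa; have F0 : F 0 by rewrite -(subrr 1); apply: FB.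
  elim/dpoly_ind: f => [c|i j|f g hf hg|f g hf hg].
  - by rewrite dpoly_evalC.
  - by rewrite dpoly_evalX; elim: j => [|j IHj] //=; apply: FD.
  - rewrite dpoly_evalD -[dpoly_eval a g]opprK; apply: (FB _ _ _) => //.
    by rewrite -[- _]add0r; apply: FB.
  - by rewrite dpoly_evalM; apply: FM.
exact: (@separable_in_prop K n L (de_inj L) (dpoly_eval a) (dpoly_evalC a) _ Fa sep).
Qed.

Lemma dpoly_eval_refl (L : diffExt K) (c : 'I_n -> diffExt_refl K) (f : R) :
  dpoly_eval (fun i => de_inj L (c i)) f = de_inj L (dpoly_eval c f).
Proof.
elim/dpoly_ind: f => [x|i j|f g hf hg|f g hf hg].
- by rewrite !dpoly_evalC.
- rewrite !dpoly_evalX; elim: j => [|j IHj] //=.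
  by rewrite IHj -de_injE.
- by rewrite !dpoly_evalD rmorphD hf hg.
- by rewrite !dpoly_evalM rmorphM hf hg.
Qed.
End GenericPoint.

(** * Quantifier-free formulas under specialisation *)

Section FormulaLocalization.
Variables (K : diffField) (n : nat) (L M : diffExt K) (R : comNzRingType) (d : R -> R).
Variables (a : 'I_n -> L) (ea : {rmorphism R -> L}).
Variables (T : Type) (c : T -> 'I_n -> M) (ec : T -> {rmorphism R -> M}).
Hypotheses (ea_der : forall f, ea (d f) = der (ea f))
           (ec_der : forall t f, ec t (d f) = der (ec t f))
           (ea_ec : forall t f, ea f = 0 -> ec t f = 0).
Hypotheses (ev_var : forall i, exists2 f, ea f = a i & forall t, ec t f = c t i)
           (ev_par : forall k, exists2 f, ea f = de_inj L k & forall t, ec t f = de_inj M k).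

(** Quotients are closed under all the operations, the derivation by the quotient rule. The only
    branching is the convention 0^-1 = 0, decided by the value at a. *)
Lemma term_localization (u : dterm K n) : exists f g, [/\ ea g != 0,
  dterm_eval a u = ea f / ea g &
  forall t, ec t g != 0 -> dterm_eval (c t) u = ec t f / ec t g].
Proof.
elim: u => [i|k| | |u1 [f1 [g1 [n1 E1 h1]]] u2 [f2 [g2 [n2 E2 h2]]]
      |u1 [f1 [g1 [n1 E1 h1]]]|u1 [f1 [g1 [n1 E1 h1]]] u2 [f2 [g2 [n2 E2 h2]]]
      |u1 [f1 [g1 [n1 E1 h1]]]|u1 [f1 [g1 [n1 E1 h1]]]] /=.
- have [f fa fc] := ev_var i; exists f, 1; rewrite rmorph1 oner_eq0 divr1.
  by split=> // t _; rewrite rmorph1 divr1.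
- have [f fa fc] := ev_par k; exists f, 1; rewrite rmorph1 oner_eq0 divr1.
  by split=> // t _; rewrite rmorph1 divr1.
- exists 0, 1; rewrite rmorph0 rmorph1 oner_eq0 divr1; split=> // t _.
  by rewrite rmorph0 mul0r.
- exists 1, 1; rewrite rmorph1 oner_eq0 divr1; split=> // t _.
  by rewrite rmorph1 divr1.
- exists (f1 * g2 + f2 * g1), (g1 * g2); rewrite rmorphD !rmorphM mulf_neq0 //.
  split=> // [|t]; first by rewrite E1 E2 addf_div.
  rewrite rmorphM mulf_eq0 negb_or => /andP [m1 m2].
  by rewrite rmorphD !rmorphM h1 // h2 // addf_div.
- exists (- f1), g1; rewrite rmorphN n1 E1 mulNr; split=> // t m1.
  by rewrite rmorphN mulNr h1.
- exists (f1 * f2), (g1 * g2); rewrite !rmorphM mulf_neq0 //.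
  split=> // [|t]; first by rewrite E1 E2 mulf_div.
  rewrite rmorphM mulf_eq0 negb_or => /andP [m1 m2].
  by rewrite !rmorphM h1 // h2 // mulf_div.
(* A numerator that vanishes at a vanishes at every c_t by [ea_ec], so the inverse is 0 there
   too. *)
- have [f10|f1n] := eqVneq (ea f1) 0.
    exists 0, g1; rewrite E1 f10 rmorph0 !mul0r invr0; split=> // t m1.
    by rewrite h1 // ea_ec ?rmorph0 ?mul0r ?invr0.
  (* The extra factor g1 keeps g1 nonzero wherever the new denominator is. *)
  exists (g1 * g1), (f1 * g1); rewrite !rmorphM mulf_neq0 // E1.
  split=> // [|t]; first by rewrite invf_div -mulf_div mulfV // mulr1.
  rewrite rmorphM mulf_eq0 negb_or => /andP [m1 m2].
  by rewrite rmorphM h1 // invf_div -mulf_div mulfV // mulr1.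
- exists (d f1 * g1 - f1 * d g1), (g1 * g1).
  rewrite rmorphB !rmorphM mulf_neq0 //; split=> // [|t].
    by rewrite E1 (derivation_div (@der_derivation L)) !ea_der.
  rewrite rmorphM mulf_eq0 orbb => m1.
  by rewrite h1 // (derivation_div (@der_derivation M)) rmorphB !rmorphM !ec_der.
Qed.

Lemma formula_localization (phi : dqf K n) : exists2 g, ea g != 0 &
  forall t, ec t g != 0 -> (dqf_holds (c t) phi <-> dqf_holds a phi).
Proof.
elim: phi => [u1 u2|phi [g gn hg]|phi1 [g1 n1 h1] phi2 [g2 n2 h2]|phi1 [g1 n1 h1] phi2 [g2 n2 h2]] /=.
- have [f1 [g1 [n1 E1 h1]]] := term_localization u1.
  have [f2 [g2 [n2 E2 h2]]] := term_localization u2.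
  have eqf (F : fieldType) (x1 y1 x2 y2 : F) : y1 != 0 -> y2 != 0 ->
      (x1 / y1 = x2 / y2 <-> x1 * y2 - x2 * y1 = 0).
    move=> y1n y2n; split=> [/eqP|/eqP].
      by rewrite eqr_div // => /eqP ->; rewrite subrr.
    by rewrite subr_eq0 -eqr_div // => /eqP.
  pose w := f1 * g2 - f2 * g1.
  have wa : ea w = ea f1 * ea g2 - ea f2 * ea g1 by rewrite rmorphB !rmorphM.
  have wc t : ec t w = ec t f1 * ec t g2 - ec t f2 * ec t g1 by rewrite rmorphB !rmorphM.
  (* An equation true at a holds at every c_t off the denominators; a false one is kept false by
     adding its numerator [w] to the conditions. *)
  have [w0|wn] := eqVneq (ea w) 0.
    exists (g1 * g2); first by rewrite rmorphM mulf_neq0.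
    move=> t; rewrite rmorphM mulf_eq0 negb_or => /andP [m1 m2].
    by rewrite E1 E2 h1 // h2 // !eqf // -wa -wc w0 ea_ec.
  exists (g1 * g2 * w); first by rewrite !rmorphM !mulf_neq0.
  move=> t; rewrite !rmorphM !mulf_eq0 !negb_or => /andP [/andP [m1 m2] m3].
  by rewrite E1 E2 h1 // h2 // !eqf // -wa -wc; split=> h; move: m3 wn; rewrite h eqxx.
- by exists g => // t m; rewrite hg.
- exists (g1 * g2); first by rewrite rmorphM mulf_neq0.
  move=> t; rewrite rmorphM mulf_eq0 negb_or => /andP [m1 m2].
  by rewrite h1 // h2.
- exists (g1 * g2); first by rewrite rmorphM mulf_neq0.
  move=> t; rewrite rmorphM mulf_eq0 negb_or => /andP [m1 m2].
  by rewrite h1 // h2.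
Qed.
End FormulaLocalization.

(** * Consequences of the existence of points *)

Section Implications.
Variable K : diffField.

Definition has_points := forall (n : nat) (P : prime_idealr (dpoly K n)),
  diff_ideal P -> separable_ideal P -> forall g : dpoly K n, g \notin P ->
  exists a : 'I_n -> diffExt_refl K,
    (forall f, f \in P -> dpoly_eval a f = 0) /\ dpoly_eval a g != 0.

Lemma separable_in_refl n (c : 'I_n -> diffExt_refl K) :
  separable_in (de_inj (diffExt_refl K)) (df_adjoin c).
Proof.
move=> p pK m b _ ind a aF a0; refine (ind a _ a0) => i.
by have [x _ ->] := aF i; exists x; [exists x|].
Qed.

(** A K-point c of the vanishing ideal of a, off the constraint g, must be generic, so the equation
    x_i = c_i passes back from c to a. *)
Lemma has_points_constrainedly_closed : has_points -> constrainedly_closed K.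
Proof.
move=> pts n L a [sep [g gn gen]] i.
have [P [PE dP sP]] := vanishing_ideal sep.
have gP : g \notin P by apply/negP => /PE /eqP; rewrite (negPf gn).
have [c [c0 cn]] := pts n P dP sP g gP.
have gc : generic_specialisation a c.
  by apply: gen => // [f /PE /c0|] //; apply: separable_in_refl.
exists (c i); apply/eqP; rewrite -subr_eq0; apply/eqP.
have c0' := etrans (dpoly_evalXsubC c i (c i)) (subrr _).
exact (etrans (esym (dpoly_evalXsubC a i (c i))) ((gc _).2 c0')).
Qed.

(** Among the zeros in K of the vanishing ideal of a, those off a suitable g satisfy the formula
    because a does. *)
Lemma has_points_separably_closed : has_points -> separably_diff_closed K.
Proof.
move=> pts L sep n phi [a ha].
have [|P [PE dP sP]] := @vanishing_ideal K n L a.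
  move=> p pK m b bK ind c cF; apply: (sep p pK m b bK ind c) => i.
  by have [x _ ->] := cF i; exists x.
pose T := {c : 'I_n -> diffExt_refl K | forall f, f \in P -> dpoly_eval c f = 0}.
have [||t f f0|i|c|g gn hg] := @formula_localization K n L (diffExt_refl K) (dpoly K n)
  (@dpoly_der K n) a (dpoly_eval a) T (fun t => sval t) (fun t => dpoly_eval (sval t)) _ _ _ _ _ phi.
- exact: dpoly_eval_der.
- by move=> t; apply: dpoly_eval_der.
- by apply: (svalP t); apply/PE.
- by exists (dpolyX K i 0); [apply: dpoly_evalX | move=> t; apply: dpoly_evalX].
- by exists (dpolyC n c); [apply: dpoly_evalC | move=> t; apply: dpoly_evalC].
have gP : g \notin P by apply/negP => /PE /eqP; rewrite (negPf gn).
have [c [c0 cn]] := pts n P dP sP g gP.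
by exists c; apply/(hg (exist _ c c0) cn).
Qed.
End Implications.

(** * The equivalences *)

Section MaximalIdeal.
Variables (K : diffField) (n : nat) (g : dpoly K n).
Implicit Types (Q : dpoly K n -> Prop).

Definition avoiding Q := [/\ prime_ideal_prop Q,
  forall f, Q f -> Q (dpoly_der f), separable_prop Q & ~ Q g].

Lemma maximal_avoiding Q0 : avoiding Q0 -> exists2 Q, avoiding Q &
  (forall f, Q0 f -> Q f) /\
  (forall Q', avoiding Q' -> (forall f, Q f -> Q' f) -> forall f, Q' f -> Q f).
Proof.
move=> av0.
(* Zorn's lemma is applied through the union with [Q0], so that the empty chain also has an
   admissible bound, namely [Q0]. *)
pose U (A : classical_sets.set (dpoly K n)) f := A f \/ Q0 f.
have [FF FP tot|A [avA maxA]] := @classical_sets.Zorn_bigcup (dpoly K n) (fun A => avoiding (U A)).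
  pose W := U (classical_sets.bigcup FF id).
  (* Each closure condition involves at most two elements of the union, and these lie in a common
     member of the chain extended by [Q0]. *)
  have dir f h : W f -> W h -> exists2 V, avoiding V /\ (forall k, V k -> W k) & V f /\ V h.
    have sub A : FF A -> avoiding (U A) /\ (forall k, U A k -> W k).
      by move=> FA; split=> [|k [Ak|Qk]]; [apply: FP | left; exists A | right].
    have sub0 : avoiding Q0 /\ (forall k, Q0 k -> W k) by split=> // k ?; right.
    move=> [[A FA Af]|Qf] [[B FB Bh]|Qh].
    - have [AB|BA] := tot A B FA FB.
        by exists (U B); [apply: sub | split; left=> //; apply: AB].
      by exists (U A); [apply: sub | split; left=> //; apply: BA].
    - by exists (U A); [apply: sub | split; [left | right]].
    - by exists (U B); [apply: sub | split; [right | left]].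
    - by exists Q0.
  have dir1 f : W f -> exists2 V, avoiding V /\ (forall k, V k -> W k) & V f.
    by move=> Wf; have [V avV [Vf _]] := dir f f Wf Wf; exists V.
  split.
  - split.
    + by right; case: av0 => -[].
    + by move=> /dir1 [V [[[_ V1 _ _] _ _ _] _] /V1].
    + move=> a f h Wf Wh; have [V [[[_ _ Vi _] _ _ _] VW] [Vf Vh]] := dir f h Wf Wh.
      by apply: VW; apply: Vi.
    + by move=> f h /dir1 [V [[[_ _ _ Vp] _ _ _] VW] /Vp [] /VW]; [left | right].
  - by move=> f /dir1 [V [[_ Vd _ _] VW] /Vd /VW].
  - move=> p pK m c ind f /dir1 [V [[_ _ Vs _] VW] Vf] i.
    by apply: VW; apply: (Vs p pK m c ind f Vf).
  - by move=> /dir1 [V [[_ _ _ Vg] _] /Vg].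
exists (U A) => //; split=> [f|Q' av' sub f Q'f]; first by right.
apply: contrapT => nUf; apply: (maxA Q').
  by split=> [h Ah|/(_ f Q'f) Af]; [apply: sub; left | apply: nUf; left].
have -> // : U Q' = Q'.
apply/funext => h; apply/propext; split=> [[]// Qh|]; last by left.
by apply: sub; right.
Qed.
End MaximalIdeal.

(** A separable specialisation, off g, of the generic zero of a maximal Q has a vanishing ideal that
    contains Q and avoids g, hence equals Q. So g constrains this zero, whose entries then lie in
    K. *)
Lemma constrainedly_closed_has_points (K : diffField) :
  constrainedly_closed K -> has_points K.
Proof.
move=> cc n P dP sP g gP.
have [|Q [Qp Qd Qs Qg] [PQ Qmax]] := @maximal_avoiding K n g (fun f => f \in P).
  split=> //; first exact: prime_idealr_prop.
    exact/separable_idealP.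
  exact/negP.
have [P' P'E] := prime_idealr_of Qp.
have dP' : diff_ideal P' by move=> f /P'E Qf; apply/P'E/Qd.
have sP' : separable_ideal P'.
  by apply/separable_idealP; apply: eq_separable_prop Qs => f; apply: iff_sym (P'E f).
have [L [a [aE sepL]]] := generic_point dP'.
have {}aE f : dpoly_eval a f = 0 <-> Q f by rewrite aE P'E.
have /choice [c ac] : forall i, exists c : K, a i = de_inj L c.
  apply: (cc n L a); split.
    move=> p pK m b bK ind d dF; apply: (sepL sP' p pK m b bK ind d) => i.
    by have [x _ ->] := dF i; exists x.
  exists g; first by apply/eqP => /aE.
  move=> M b spec sepM gb f; split=> [/spec //|bf]; apply/aE.
  have [P'' [P''E dP'' sP'']] := vanishing_ideal sepM.
  apply: (Qmax (fun f => f \in P'')); last exact/P''E.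
    split=> //; first exact: prime_idealr_prop.
      exact/separable_idealP.
    by move=> /P''E /eqP; rewrite (negPf gb).
  by move=> h /aE /spec ?; apply/P''E.
have evc f : dpoly_eval a f = de_inj L (dpoly_eval (c : 'I_n -> diffExt_refl K) f).
  by have -> : a = (fun i => de_inj L (c i)); [apply/funext | apply: dpoly_eval_refl].
exists c; split=> [f /PQ /aE|].
  by rewrite evc => /eqP; rewrite fmorph_eq0 => /eqP.
by apply/eqP => g0; apply: Qg; apply/aE; rewrite evc g0 rmorph0.
Qed.

(** The map [psi] makes X_r a new variable and fixes the coefficients, so it turns the value of [Q]
    at X_r back into [Q]. *)
Lemma Pol_transcendental (K : diffField) (R : comNzRingType) (C : {rmorphism K -> R})
    (X : nat -> R) (psi : {rmorphism R -> {poly R}}) r :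
  (forall c, psi (C c) = (C c)%:P) -> (forall s, (s < r)%N -> psi (X s) = (X s)%:P) ->
  psi (X r) = 'X ->
  forall Q : {poly R}, Q \is a polyOver (Pol C X r) -> Q.[X r] = 0 -> Q = 0.
Proof.
move=> psiC psiX psir Q hQ Q0.
have psiP f : f \in Pol C X r -> psi f = f%:P.
  move: f; apply: rgen_ind => [|x y hx hy|x y hx hy|y [[c ->]|[s sr ->]]] //.
  - by rewrite rmorph1.
  - by rewrite rmorphB hx hy polyCB.
  - by rewrite rmorphM hx hy polyCM.
  - exact: psiX.
have := congr1 psi Q0; rewrite rmorph0 -horner_map psir /= => <-.
rewrite -[LHS]comp_polyXr /comp_poly; congr (_.[_]).
by apply/polyP => i; rewrite !coef_map /= psiP //; move/polyOverP: hQ; apply.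
Qed.

(** If the derivatives of x were independent, exchange with the N elements z_s would leave one of
    them transcendental over a field that contains it. *)
Lemma finite_stage_diff_algebraic (K : diffField) (L L' : diffExt K)
    (v : {rmorphism L' -> L}) N (z : nat -> L) :
  (forall c, v (de_inj L' c) = de_inj L c) ->
  (forall x, v x \in sgen (fun y => y \in base_field (de_inj L) \/
                                    exists2 s, (s < N)%N & y = z s)) ->
  diff_algebraic L'.
Proof.
move=> vC vN x; pose zz r := v (iter r der x).
have [r algr] : exists r, algebraic_over (seq_field (base_field (de_inj L)) (fun=> True) zz z 0 r) (zz r).
  apply: contrapT => none.
  have [r _|R0 hR] := @seq_field_exchange L (base_field (de_inj L)) (fun=> True) zz z N.
    by move=> alg; apply: none; exists r.
  apply: (hR R0) => //; apply: mem_algebraic; move: (vN (iter R0 der x)).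
  by apply: sgen_min => y [?|?]; apply/sgen_mem; [apply: Or31 | apply: Or32].
pose R := dpoly K 1; pose X s : R := dpolyX K ord0 s.
pose ev : {rmorphism R -> L'} := dpoly_eval (fun=> x).
pose eps : {rmorphism R -> L} := (v \o ev : {rmorphism R -> L}).
have epsC c : eps (dpolyC 1 c) = de_inj L c.
  by rewrite -vC; apply: (congr1 v); apply: dpoly_evalC.
have epsX s : gen_pt X eps s = zz s.
  by apply: (congr1 v); apply: dpoly_evalX.
have [q Eq [qn qe]] : algebraic_over (stage X eps r) (zz r).
  apply: algebraic_overS algr; apply: sgen_min => y [?|[]//|[s [sr _] ->]].
    by apply/sgen_mem; left.
  by rewrite -epsX; apply: stage_pt.
have [h [_ hn] [Q hQ QE]] := @stage_poly K R (@dpolyC K 1) X L eps epsC r q Eq.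
have Qf : eps Q.[X r] = 0.
  by rewrite -horner_map QE hornerZ (epsX r : eps (X r) = zz r) qe mulr0.
exists Q.[X r]; last first.
  by have /eqP := Qf; rewrite fmorph_eq0 => /eqP.
have {Qf}Qn : Q != 0.
  apply/eqP => Q0; move: QE; rewrite Q0 map_poly0 => /esym/eqP.
  by rewrite scaler_eq0 (negPf hn) (negPf qn).
(* Replacing only the r-th derivative by a new variable shows that the differential polynomial
   obtained is nonzero. *)
pose xs (w : 'I_1 * nat) : {poly R} := if w.2 == r then 'X else (dpolyX K w.1 w.2)%:P.
pose phi : {rmorphism K -> {poly R}} := (polyC \o @dpolyC K 1 : {rmorphism K -> {poly R}}).
pose psi : {rmorphism R -> {poly R}} := dpoly_value phi xs.
apply: contra_neq Qn; apply: (@Pol_transcendental K R (@dpolyC K 1) X psi r) => //.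
- by move=> c; apply: (dpoly_valueC phi xs c).
- move=> s sr; refine (etrans (dpoly_valueX phi xs ord0 s) _).
  by rewrite /xs /= ltn_eqF.
- refine (etrans (dpoly_valueX phi xs ord0 r) _).
  by rewrite /xs /= eqxx.
Qed.

Lemma separable_ext_sub (K L L' : fieldType) (iota : {rmorphism K -> L})
    (iota' : {rmorphism K -> L'}) (v : {rmorphism L' -> L}) :
  (forall c, v (iota' c) = iota c) -> separable_ext iota -> separable_ext iota'.
Proof.
move=> vE sep K' p pK m b bK ind a aF a0 i; apply: (fmorph_inj v); rewrite rmorph0; move: i.
apply: (sep p pK m (fun i => v (b i)) _ _ (fun i => v (a i))).
- by move=> i; have [c ->] := bK i; exists c; rewrite vE.
- move=> d dp d0.
  have /choice [y hy] : forall i, exists y, d i = iota (y ^+ p).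
    by move=> i; have [_ [y ->] ->] := dp i; exists y; rewrite rmorphXn.
  move=> i; rewrite hy -vE (ind (fun i => iota' (y i ^+ p))) ?rmorph0 // => [j|].
    by exists (iota' (y j)); [exists (y j) | rewrite rmorphXn].
  apply: (fmorph_inj v); rewrite rmorph0 -[RHS]d0 rmorph_sum.
  by apply: eq_bigr => j _; rewrite rmorphM vE hy.
- by move=> i; have [y _ ->] := aF i; exists (v y); rewrite // rmorphXn.
by rewrite -[RHS](rmorph0 v) -a0 rmorph_sum; apply: eq_bigr => i _; rewrite rmorphM.
Qed.

(** * Enumeration of the differential indeterminates *)

Section DPolyEnumeration.
Variables (K : diffField) (n : nat).

(* The indeterminates in order of increasing derivative; the dummy value 0 in
   position n of each block keeps the block length positive when n = 0. *)
Definition dpoly_var r : dpoly K n :=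
  oapp (fun i : 'I_n => dpolyX K i (r %/ n.+1)%N) 0 (insub (r %% n.+1)%N).

Lemma dpoly_var_der r : dpoly_der (dpoly_var r) = dpoly_var (r + n.+1).
Proof.
rewrite /dpoly_var modnDr divnDr ?dvdnn // divnn addn1.
case: (insub (r %% n.+1)%N : option 'I_n) => [i|] /=; first exact: dpoly_derX.
exact: (derivation0 (@dpoly_der_derivation K n)).
Qed.

Lemma dpoly_varE (i : 'I_n) j : dpoly_var (i + j * n.+1) = dpolyX K i j.
Proof.
have lt_i : (i < n.+1)%N by rewrite ltnS ltnW.
have mod_i : ((i + j * n.+1) %% n.+1 = i)%N by rewrite addnC modnMDl modn_small.
have div_j : ((i + j * n.+1) %/ n.+1 = j)%N by rewrite addnC divnMDl // divn_small ?addn0.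
by rewrite /dpoly_var mod_i div_j valK.
Qed.

Lemma dpoly_varP r : (exists i : 'I_n, exists j, r = (i + j * n.+1)%N) \/ dpoly_var r = 0.
Proof.
have [lt_r|le_r] := ltnP (r %% n.+1) n.
  by left; exists (Ordinal lt_r), (r %/ n.+1)%N; rewrite /= addnC -divn_eq.
by right; rewrite /dpoly_var insubF // ltnNge le_r.
Qed.

Lemma dpoly_Pol (f : dpoly K n) : exists r, f \in Pol (@dpolyC K n) dpoly_var r.
Proof.
elim/dpoly_ind: f => [c|i j|f g [r hf] [s hg]|f g [r hf] [s hg]].
- by exists 0%N; apply: PolC.
- by exists (i + j * n.+1).+1; rewrite -dpoly_varE; apply: PolX.
- by exists (maxn r s); apply: rpredD;
    [apply: (PolS _ hf); apply: leq_maxl | apply: (PolS _ hg); apply: leq_maxr].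
- by exists (maxn r s); apply: rpredM;
    [apply: (PolS _ hf); apply: leq_maxl | apply: (PolS _ hg); apply: leq_maxr].
Qed.
End DPolyEnumeration.

Lemma diff_algebraic_closed_has_points (K : diffField) :
  (forall L : diffExt K, diff_algebraic L -> separable_ext (de_inj L) ->
     existentially_closed L) -> has_points K.
Proof.
move=> ec n P dP sP g gP.
have [L [a [aE sepL]]] := generic_point dP; have {}sepL := sepL sP.
pose R := dpoly K n; pose X := @dpoly_var K n.
pose C : {rmorphism K -> R} := @dpolyC K n.
pose eps : {rmorphism R -> L} := dpoly_eval a.
have dd : derivation (@dpoly_der K n) := @dpoly_der_derivation K n.
have dC c : dpoly_der (C c) = C (der c) := dpoly_derC n c.
have epsC c : eps (C c) = de_inj L c := dpoly_evalC a c.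
have eps_der f : eps (dpoly_der f) = der (eps f) := dpoly_eval_der a f.
have [N0 stable0] := stable_stage dd dC (ltn0Sn n) (@dpoly_var_der K n) epsC eps_der sepL.
have [m0 gm0] := dpoly_Pol g.
(* Large enough for stability, for g to involve only the first N indeterminates, and for the
   coordinates a_i to be among the first N generators. *)
pose N := maxn N0 (maxn m0 n).
have NN0 : (N0 <= N)%N by rewrite leq_maxl.
have stableN r (Nr : (N <= r)%N) := stable0 r (leq_trans NN0 Nr).
have gN : g \in Pol C X N by apply: (PolS _ gm0); rewrite /N; lia.
have [fs [h [hfs hh hn spec]]] :=
  finite_presentation dd dC (ltn0Sn n) (@dpoly_var_der K n) epsC eps_der stableN.
have [L' [v [vC vN vsurj vder]]] := stage_diffExt (ltn0Sn n) (@dpoly_var_der K n) eps_der stableN.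
have ecL' : existentially_closed L'.
  apply: ec; last exact: separable_ext_sub vC sepL.
  exact: finite_stage_diff_algebraic vC vN.
have nN : (n <= N)%N by rewrite /N; lia.
have /choice [b bE] : forall i : 'I_n, exists y : L', v y = gen_pt X eps i.
  by move=> i; apply: vsurj; apply: stage_pt; apply: leq_trans nN.
(* Below N the derivation of [L'] yields the same derivatives as that of [L]; from N on they may
   differ. *)
have vb (i : 'I_n) j : (i + j * n.+1 < N)%N -> v (iter j der (b i)) = gen_pt X eps (i + j * n.+1).
  elim: j => [|j IHj] ltN; first by rewrite /= bE addn0.
  rewrite iterS mulSnr addnA; apply: vder; first by rewrite -addnA -mulSnr.
  by apply: IHj; apply: leq_trans ltN; rewrite ltnS mulSnr addnA leq_addr.
(* So b satisfies the same relations as a in the first N indeterminates, though it need not be a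
   zero of all of P. *)
have vev f : f \in Pol C X N -> v (dpoly_eval b f) = eps f.
  pose w : {rmorphism R -> L} := (v \o (dpoly_eval b : {rmorphism R -> L'}) : {rmorphism R -> L}).
  change (f \in Pol C X N -> w f = eps f).
  have wC c : w (C c) = eps (C c).
    by rewrite epsC -vC; apply: (congr1 v); apply: dpoly_evalC.
  have wX s : (s < N)%N -> w (X s) = eps (X s).
    move=> sN; have [[i [j sE]]|X0] := dpoly_varP K n s; last by rewrite /X X0 !rmorph0.
    rewrite sE in sN *; refine (etrans _ (vb i j sN)); apply: (congr1 v).
    by rewrite /X dpoly_varE; apply: dpoly_evalX.
  clearbody w eps C X; move: f; apply: rgen_ind => [|x y hx hy|x y hx hy|y [[c ->]|[s sr ->]]].
  - by rewrite !rmorph1.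
  - by rewrite !rmorphB hx hy.
  - by rewrite !rmorphM hx hy.
  - exact: wC.
  - exact: wX.
(* One inequation takes care both of the condition [h] of the presentation and of the required g;
   [spec] then passes from the equations [fs] to all of P. *)
have [||c c0 cn] := @existentially_closed_dpoly K n L' b fs (h * g) ecL'.
- move=> f /hfs [fN f0]; apply: (fmorph_inj v); rewrite rmorph0.
  exact: etrans (vev f fN) f0.
- rewrite dpoly_evalM mulf_neq0 //; rewrite -(fmorph_eq0 v) vev //.
  by apply/eqP => /aE; apply/negP.
move: cn; rewrite dpoly_evalM mulf_eq0 negb_or => /andP [ch cg].
exists c; split=> // f fP; have [r hf] := dpoly_Pol f.
apply: (spec (diffExt_refl K) (dpoly_eval c) _ c0 ch r f hf).
  exact: dpoly_eval_der.
exact/aE.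
Qed.

Theorem theorem4p9 (K : diffField) :
  [<-> separably_diff_closed K;
       forall L : diffExt K, diff_algebraic L -> separable_ext (de_inj L) ->
         existentially_closed L;
       constrainedly_closed K;
       forall (n : nat) (P : prime_idealr (dpoly K n)),
         diff_ideal P -> separable_ideal P ->
         forall g : dpoly K n, g \notin P ->
         exists a : 'I_n -> diffExt_refl K,
           (forall f, f \in P -> dpoly_eval a f = 0) /\ dpoly_eval a g != 0].
Proof.
tfae=> [h L _|h|h|h].
- exact: h.
(* The step from (2) to (3) goes through (4). *)
- exact: has_points_constrainedly_closed (diff_algebraic_closed_has_points h).
- exact: constrainedly_closed_has_points.
- exact: has_points_separably_closed.
Qed.
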